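(* Let $\beta\geq-1/3$. For every integer $m\geq1$, with $\Theta_j$ the inverse Prüfer phase and $R_j=r_j\circ\Theta_j$ the Prüfer amplitude as a function of phase for the weighted Jacobi–Radau function $Q_j^{(\beta)}$, and $S_m=(m-\tfrac12)\pi$, $$\Theta_{m+1}(s)<\Theta_m(s)\quad\text{and}\quad R_{m+1}(s)>R_m(s),\qquad 0<s\leq S_m.$$
   Context: $P_n^{(\alpha,\beta)}$ is the Jacobi polynomial of degree $n$ normalised by $P_n^{(\alpha,\beta)}(1)=(\alpha+1)_n/n!$. For $\beta\ge-1/3$ and integers $m\geq1$ put $$Q_m^{(\beta)}(x)=2^{-\beta-1}(1+x)^{\beta+1}P_{m-1}^{(0,\beta+1)}(x),\qquad x\in[-1,1],$$ $\omega_m=\sqrt{m(m+\beta)}$, and $Y_m(\theta)=Q_m^{(\beta)}(\cos\theta)$ for $0\leq\theta\leq\pi$. Prüfer amplitude: $r_m(\theta)=\bigl(Y_m(\theta)^2+Y_m'(\theta)^2/\omega_m^2\bigr)^{1/2}$. It is positive on $[0,\pi)$, and $r_m(\pi)=0$ by continuity. Prüfer phase: $\phi_m:[0,\pi)\to\mathbb R$ is the unique continuous function with $\phi_m(0)=0$ and $$Y_m=r_m\cos\phi_m,\qquad Y_m'=-\omega_m r_m\sin\phi_m.$$ Put $S_m=(m-\tfrac12)\pi$. One has $\phi_m(\theta)\to S_m$ as $\theta\uparrow\pi$; setting $\phi_m(\pi):=S_m$, the map $\phi_m:[0,\pi]\to[0,S_m]$ is an increasing homeomorphism. Its inverse is denoted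 $\Theta_m:[0,S_m]\to[0,\pi]$, and $R_m(s):=r_m(\Theta_m(s))$ for $0\leq s\leq S_m$. *)

(* Defs.v *)
From Stdlib Require Import Arith Factorial Reals ClassicalEpsilon.
From Coquelicot Require Import Coquelicot.
Open Scope R_scope.

Fixpoint pochhammer (a : R) (n : nat) : R :=
  match n with
  | O => 1
  | S k => pochhammer a k * (a + INR k)
  end.

(* Szego's expansion of P_n^(a,b) about x = 1 (Orthogonal Polynomials, (4.21.2)).
   It makes sense for all real a, b, and the k = 0 term gives
   P_n^(a,b)(1) = (a+1)_n / n!. *)
Definition jacobi (n : nat) (a b x : R) : R :=
  / INR (fact n) *
  sum_f_R0 (fun k => Binomial.C n k * pochhammer (INR n + a + b + 1) k
                     * pochhammer (a + INR k + 1) (n - k) * ((x - 1) / 2) ^ k) n.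

(* Real power of a base u >= 0 with exponent a > 0.  [Rpower] alone would be
   wrong at the endpoint, since [Rpower 0 a = 1]. *)
Definition pos_power (u a : R) : R :=
  if Rle_dec u 0 then 0 else Rpower u a.

(* m >= 1 *)
Definition Q (beta : R) (m : nat) (x : R) : R :=
  Rpower 2 (- beta - 1) * pos_power (1 + x) (beta + 1)
  * jacobi (m - 1) 0 (beta + 1) x.

Definition omega (beta : R) (m : nat) : R := sqrt (INR m * (INR m + beta)).

Definition Y (beta : R) (m : nat) (theta : R) : R := Q beta m (cos theta).

(* As a function on all of R, [Y beta m] is even about 0 and about PI, and it is
   differentiable there because 2 * (beta + 1) > 1.  So the two-sided derivative
   agrees with the one-sided derivative at the endpoints of [0, PI]. *)
Definition dY (beta : R) (m : nat) (theta : R) : R := Derive (Y beta m) theta.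

Definition amplitude (beta : R) (m : nat) (theta : R) : R :=
  sqrt (Y beta m theta ^ 2 + dY beta m theta ^ 2 / omega beta m ^ 2).

Definition phase_end (m : nat) : R := (INR m - 1 / 2) * PI.

Definition is_prufer_phase (beta : R) (m : nat) (phi : R -> R) : Prop :=
  continuous_on (fun theta => 0 <= theta < PI) phi /\
  phi 0 = 0 /\
  forall theta, 0 <= theta < PI ->
    Y beta m theta = amplitude beta m theta * cos (phi theta) /\
    dY beta m theta
      = - omega beta m * amplitude beta m theta * sin (phi theta).

(* [is_prufer_phase] determines the phase on [0, PI) only; [epsilon] picks a
   representative, and the value at PI is the limit [phase_end m]. *)
Definition phase (beta : R) (m : nat) (theta : R) : R :=
  if Rlt_dec theta PI
  then epsilon (inhabits (fun _ : R => 0)) (is_prufer_phase beta m) theta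
  else phase_end m.

(* The inverse of [phase beta m : [0, PI] -> [0, phase_end m]]. *)
Definition Theta (beta : R) (m : nat) (s : R) : R :=
  epsilon (inhabits 0)
    (fun theta => 0 <= theta <= PI /\ phase beta m theta = s).

Definition amplitude_of_phase (beta : R) (m : nat) (s : R) : R :=
  amplitude beta m (Theta beta m s).

(* Main.v *)
(* In the angle, Y_m solves Y'' + a Y' + omega_m^2 Y = 0 with
   a = (1 + beta - beta cos) / sin, so the phase obeys
   phi' = omega_m - a sin phi cos phi.  The phase increases: once
   Y'^2 - Y Y'' becomes nonpositive it stays so, which bounds Y' / Y near PI and
   contradicts Y(PI) = 0.  At a common value the phase with the larger frequency has
   the larger slope, whence phi_m < phi_(m+1) and Theta_(m+1) < Theta_m; moreover two
   phases cannot have the same limit at PI, and since P_(m-1) has at most m - 1 roots,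
   induction on m gives phi_m(PI-) = S_m.

   For the amplitudes use p_m(s) = omega_m / a(Theta_m(s)), for which
   p_m' = (1/a)'(Theta_m) p_m / (p_m - sin s cos s) and
   (ln R_m)' = - sin^2 s / (p_m - sin s cos s).  Where p_(m+1) <= p_m, the order of the
   Theta's puts Theta_(m+1) on the increasing branch of 1/a; there (1/a)' is decreasing
   in the angle exactly because beta >= -1/3, so p_(m+1) crosses p_m only upwards.
   Hence p_(m+1) > p_m, and R_(m+1) / R_m increases from 1. *)

Require Import Defs.
From Stdlib Require Import Reals.
From Stdlib Require Import Lra Lia Factorial Ranalysis5 ClassicalEpsilon.
From Coquelicot Require Import Coquelicot.
Open Scope R_scope.

(** * Comparison lemmas for derivatives *)

(** The coefficient a is singular at 0 and at [PI], so neither the equation nor its phase form can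
    be started at an endpoint. At 0 the remedy is to extend Y evenly to (-PI, PI) and to define the
    phase as the integral of omega (Y'^2 - Y Y'') / (omega^2 Y^2 + Y'^2), a quotient that is
    continuous at 0 and does not contain the phase. At [PI] the phase analysis uses only that Y is
    continuous with Y(PI) = 0, in the form that no bound Y Y' >= - c Y^2 can hold up to [PI]; hence
    the cosine of the phase comes arbitrarily close to 0 there.

    Every p_m tends to 0 as s does, so p_m and p_(m+1) have no strict inequality to start from. A
    sign argument replaces it: p / (p - sin s cos s) is nonincreasing in p when sin s cos s >= 0, so
    near s = 0 the difference p_(m+1) - p_m increases wherever it is nonpositive.

    The bound -1/3 comes from the angle 0: with x for the cosine, (1/a)' is ((1 + beta) x - beta) /
    (1 + beta - beta x)^2, whose slope at x = 1 is 1 + 3 beta. *)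

Lemma is_derive_pos_near (f : R -> R) (x d : R) :
  is_derive f x d -> 0 < d ->
  exists eps, 0 < eps /\ forall h, 0 < h < eps -> f (x - h) < f x < f (x + h).
Proof.
  intros Hf Hd. apply is_derive_Reals in Hf.
  destruct (Hf d Hd) as [delta Hdelta].
  exists delta. split; [apply cond_pos|]. intros h Hh.
  assert (Hp : Rabs ((f (x + h) - f x) / h - d) < d).
  { apply Hdelta; [lra|]. rewrite Rabs_pos_eq; lra. }
  assert (Hm : Rabs ((f (x + - h) - f x) / - h - d) < d).
  { apply Hdelta; [lra|]. rewrite Rabs_Ropp, Rabs_pos_eq; lra. }
  apply Rabs_def2 in Hp. apply Rabs_def2 in Hm.
  assert (Hp' : 0 < (f (x + h) - f x) / h) by lra.
  assert (Hm' : 0 < (f (x + - h) - f x) / - h) by lra.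
  replace (x + - h) with (x - h) in Hm' by ring.
  split.
  - replace (f x) with (f (x - h) + h * ((f (x - h) - f x) / - h)) by (field; lra).
    nra.
  - replace (f (x + h)) with (f x + h * ((f (x + h) - f x) / h)) by (field; lra).
    nra.
Qed.

Lemma continuous_near (f : R -> R) (x eps : R) :
  continuous f x -> 0 < eps ->
  exists delta, 0 < delta /\ forall u, Rabs (u - x) < delta -> Rabs (f u - f x) < eps.
Proof.
  intros Hf Heps.
  destruct (proj1 (filterlim_locally f (f x)) Hf (mkposreal eps Heps)) as [d Hd].
  exists d. split; [apply cond_pos|]. intros u Hu. exact (Hd u Hu).
Qed.

Lemma is_derive_continuous (f : R -> R) (x d : R) : is_derive f x d -> continuous f x.
Proof. intros H. apply (ex_derive_continuous f x). exists d. exact H. Qed.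

Lemma continuous_sqr (f : R -> R) t : continuous f t -> continuous (fun u => f u ^ 2) t.
Proof.
  intros Hf. apply continuous_ext with (fun u => mult (f u) (f u)).
  - intros u. unfold mult. simpl. ring.
  - apply (continuous_mult f f t Hf Hf).
Qed.

Lemma nonneg_derive_le (f df : R -> R) (a b x y : R) :
  (forall u, a < u < b -> is_derive f u (df u)) ->
  (forall u, x < u < y -> 0 <= df u) ->
  a < x -> x <= y -> y < b -> f x <= f y.
Proof.
  intros Hf Hd Hx [Hlt|Heq] Hy; [|subst; lra].
  destruct (MVT_cor2 f df x y Hlt) as [c [Hc Hcr]].
  - intros c Hc. apply is_derive_Reals, Hf. lra.
  - specialize (Hd c Hcr). nra.
Qed.

Lemma pos_derive_lt (f df : R -> R) (a b x y : R) :
  (forall u, a < u < b -> is_derive f u (df u)) ->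
  (forall u, x < u < y -> 0 < df u) ->
  a < x -> x < y -> y < b -> f x < f y.
Proof.
  intros Hf Hd Hx Hlt Hy.
  destruct (MVT_cor2 f df x y Hlt) as [c [Hc Hcr]].
  - intros c Hc. apply is_derive_Reals, Hf. lra.
  - specialize (Hd c Hcr). nra.
Qed.

(** The increment [k] of [g] satisfies [f (x + k) = f x + h], so [k / h] is the reciprocal of a
    difference quotient of [f]. Continuity of [g] makes [k] small, and continuity of the reciprocal
    at [d] concludes. *)
Lemma is_derive_inverse (f g : R -> R) (x d eps : R) :
  is_derive f x d -> d <> 0 -> 0 < eps ->
  (forall s, Rabs (s - f x) < eps -> f (g s) = s) ->
  g (f x) = x -> continuous g (f x) ->
  is_derive g (f x) (/ d).
Proof.
  intros Hf Hd Heps Hfg Hx Hg.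
  apply is_derive_Reals in Hf. apply is_derive_Reals.
  intros e He.
  assert (Hinv : continuous Rinv d).
  { apply (continuous_Rinv d Hd). }
  destruct (continuous_near _ _ _ Hinv He) as [eta [Heta Hq]].
  destruct (Hf eta Heta) as [df Hdf].
  destruct (continuous_near _ _ _ Hg (cond_pos df)) as [dg [Hdg Hgk]].
  assert (Hmin : 0 < Rmin dg eps) by (apply Rmin_pos; lra).
  exists (mkposreal _ Hmin). simpl. intros h Hh Hhd.
  assert (Hh1 := Rmin_l dg eps). assert (Hh2 := Rmin_r dg eps).
  set (k := g (f x + h) - x).
  assert (Hk : f (x + k) = f x + h).
  { unfold k. replace (x + (g (f x + h) - x)) with (g (f x + h)) by ring.
    apply Hfg. replace (f x + h - f x) with h by ring. lra. }
  assert (Hk0 : k <> 0).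
  { intros E. rewrite E, Rplus_0_r in Hk. lra. }
  assert (Hkd : Rabs k < df).
  { unfold k. rewrite <- Hx at 2. apply Hgk. replace (f x + h - f x) with h by ring. lra. }
  specialize (Hq _ (Hdf k Hk0 Hkd)). rewrite Hk in Hq.
  rewrite Hx. fold k.
  replace (f x + h - f x) with h in Hq by ring.
  replace (k / h) with (/ (h / k)); [exact Hq|].
  field. split; assumption.
Qed.

(** If [e z < 0], let [t] be the supremum of the points of [[x, z]] where [e] is nonnegative. By
    continuity [e t = 0], and the positive derivative there yields nonnegative values beyond [t]. A
    zero at [y] itself would have negative values just before it. *)
Lemma upward_zeros_stay_pos (e de : R -> R) (x y : R) :
  (forall u, x <= u <= y -> is_derive e u (de u)) ->
  (forall u, x <= u <= y -> e u = 0 -> 0 < de u) ->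
  0 <= e x -> x < y -> 0 < e y.
Proof.
  intros Hde Hup Hx Hxy.
  assert (Hneg : forall z, x < z <= y -> ~ e z < 0).
  { intros z Hz Hez.
    destruct (completeness (fun u => x <= u <= z /\ 0 <= e u)) as [t [Hub Hlub]].
    { exists z. intros u [Hu _]. lra. }
    { exists x. split; lra. }
    assert (Hxt : x <= t) by (apply Hub; split; lra).
    assert (Htz : t <= z) by (apply Hlub; intros u [Hu _]; lra).
    assert (Hct : continuous e t).
    { apply (is_derive_continuous e t (de t)), Hde. lra. }
    assert (Het : e t = 0).
    { destruct (Rtotal_order (e t) 0) as [H|[H|H]]; [exfalso|exact H|exfalso].
      - destruct (continuous_near e t (- e t) Hct) as [d [Hd Hnear]]; [lra|].
        assert (Ht : t <= t - d); [|lra].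
        apply Hlub. intros u [Hu Heu]. apply Rnot_lt_le. intros Hud.
        assert (u <= t) by (apply Hub; split; lra).
        assert (Hu' : Rabs (u - t) < d) by (rewrite <- Rabs_Ropp, Rabs_pos_eq; lra).
        apply Hnear, Rabs_def2 in Hu'. lra.
      - assert (t <> z) by (intros ->; lra).
        destruct (continuous_near e t (e t) Hct) as [d [Hd Hnear]]; [lra|].
        assert (Hm : 0 < Rmin (d / 2) (z - t)) by (apply Rmin_pos; lra).
        assert (H1 := Rmin_l (d / 2) (z - t)). assert (H2 := Rmin_r (d / 2) (z - t)).
        set (h := Rmin (d / 2) (z - t)) in *.
        assert (Hu' : Rabs (t + h - t) < d).
        { replace (t + h - t) with h by ring. rewrite Rabs_pos_eq; lra. }
        apply Hnear, Rabs_def2 in Hu'.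
        assert (t + h <= t); [|lra]. apply Hub. split; lra. }
    assert (t <> z) by (intros ->; lra).
    destruct (is_derive_pos_near e t (de t)) as [d [Hd Hnear]];
      [apply Hde; lra | apply Hup; lra |].
    assert (Hm : 0 < Rmin (d / 2) (z - t)) by (apply Rmin_pos; lra).
    assert (H1 := Rmin_l (d / 2) (z - t)). assert (H2 := Rmin_r (d / 2) (z - t)).
    set (h := Rmin (d / 2) (z - t)) in *.
    destruct (Hnear h) as [_ Hh]; [lra|].
    assert (t + h <= t); [|lra]. apply Hub. split; lra. }
  destruct (Rtotal_order (e y) 0) as [H|[H|H]]; [exfalso|exfalso|exact H].
  - apply (Hneg y); lra.
  - destruct (is_derive_pos_near e y (de y)) as [d [Hd Hnear]];
      [apply Hde; lra | apply Hup; lra |].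
    assert (Hm : 0 < Rmin (d / 2) ((y - x) / 2)) by (apply Rmin_pos; lra).
    assert (H1 := Rmin_l (d / 2) ((y - x) / 2)). assert (H2 := Rmin_r (d / 2) ((y - x) / 2)).
    set (h := Rmin (d / 2) ((y - x) / 2)) in *.
    destruct (Hnear h) as [Hh _]; [lra|].
    apply (Hneg (y - h)); lra.
Qed.

(* No expansion of [e] at 0 is needed: a nonpositive value near 0 would make [e]
   negative and increasing on the whole interval down to its limit 0. *)
Lemma upward_zeros_pos_from_limit_zero (e de : R -> R) (b delta : R) :
  0 < delta -> delta < b ->
  (forall u, 0 < u < b -> is_derive e u (de u)) ->
  (forall u, 0 < u < b -> e u = 0 -> 0 < de u) ->
  (forall u, 0 < u < delta -> e u <= 0 -> 0 < de u) ->
  (forall eps, 0 < eps ->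
    exists d, 0 < d /\ forall u, 0 < u < d -> Rabs (e u) < eps) ->
  forall u, 0 < u < b -> 0 < e u.
Proof.
  intros Hdelta Hdb Hde Hup Hnear0 Hlim.
  assert (Hpos : forall u, 0 < u < delta -> 0 < e u).
  { intros u Hu. apply Rnot_le_lt. intros Heu.
    assert (Hneg : forall v, 0 < v < u -> e v < 0).
    { intros v Hv. apply Rnot_le_lt. intros Hev.
      assert (0 < e u); [|lra].
      apply (upward_zeros_stay_pos e de v u); try lra.
      - intros z Hz. apply Hde. lra.
      - intros z Hz. apply Hup. lra. }
    assert (Hu2 : e (u / 2) < 0) by (apply Hneg; lra).
    destruct (Hlim (- e (u / 2))) as [d [Hd Hsmall]]; [lra|].
    assert (Hm : 0 < Rmin (d / 2) (u / 4)) by (apply Rmin_pos; lra).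
    assert (H1 := Rmin_l (d / 2) (u / 4)). assert (H2 := Rmin_r (d / 2) (u / 4)).
    set (v := Rmin (d / 2) (u / 4)) in *.
    assert (Hv : Rabs (e v) < - e (u / 2)) by (apply Hsmall; lra).
    apply Rabs_def2 in Hv.
    assert (e v < e (u / 2)); [|lra].
    apply (pos_derive_lt e de 0 b); try lra; [exact Hde|].
    intros z Hz. apply Hnear0; [lra|]. left. apply Hneg. lra. }
  intros u Hu. destruct (Rlt_le_dec u delta) as [Hud|Hud]; [apply Hpos; lra|].
  apply (upward_zeros_stay_pos e de (delta / 2) u); try lra.
  - intros z Hz. apply Hde. lra.
  - intros z Hz. apply Hup. lra.
  - left. apply Hpos. lra.
Qed.

(** * The differential equation and its Pruefer phase *)

(* The coefficient a of Y' is singular at t = 0; [damping_inv] is the regular 1 / a. *)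
Definition damping_den (beta t : R) : R := 1 + beta - beta * cos t.
Definition damping_inv (beta t : R) : R := sin t / damping_den beta t.
Definition damping_inv' (beta t : R) : R :=
  ((1 + beta) * cos t - beta) / damping_den beta t ^ 2.

Lemma damping_den_pos (beta t : R) : - (1 / 3) <= beta -> 0 < damping_den beta t.
Proof.
  intros Hb. unfold damping_den. assert (H := COS_bound t). nra.
Qed.

Lemma damping_inv_pos (beta t : R) :
  - (1 / 3) <= beta -> 0 < t < PI -> 0 < damping_inv beta t.
Proof.
  intros Hb Ht. apply Rdiv_lt_0_compat; [apply sin_gt_0; lra|].
  apply damping_den_pos, Hb.
Qed.

Lemma is_derive_damping_inv (beta t : R) :
  - (1 / 3) <= beta -> is_derive (damping_inv beta) t (damping_inv' beta t).
Proof.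
  intros Hb. assert (H := damping_den_pos beta t Hb). unfold damping_den in H.
  unfold damping_inv, damping_inv', damping_den. auto_derive; [lra|].
  assert (Hs := sin2_cos2 t). unfold Rsqr in Hs.
  field_simplify; try lra.
  f_equal. replace (sin t ^ 2) with (1 - cos t ^ 2) by (simpl; lra). ring.
Qed.

(** The exponent is an antiderivative of a: [(1 + beta)] times one of 1 / sin, minus
    [beta * ln (sin t)]. Multiplication by [p] turns y'' + a y' into (p y')' / p. *)
Lemma damping_integrating_factor (beta : R) :
  - (1 / 3) <= beta ->
  exists p : R -> R, forall t, 0 < t < PI ->
    0 < p t /\ is_derive p t (p t / damping_inv beta t).
Proof.
  intros Hb.
  exists (fun t => exp ((1 + beta) / 2 * (ln (1 - cos t) - ln (1 + cos t))
                        - beta * ln (sin t))).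
  intros t Ht. split; [apply exp_pos|].
  assert (Hs : 0 < sin t) by (apply sin_gt_0; lra).
  assert (Hsc := sin2_cos2 t). unfold Rsqr in Hsc.
  assert (Hc : -1 < cos t < 1) by nra.
  assert (H := damping_den_pos beta t Hb).
  assert (E1 : sin t / (1 - cos t) = (1 + cos t) / sin t).
  { apply (Rmult_eq_reg_r ((1 - cos t) * sin t)); [|nra]. field_simplify; lra. }
  assert (E2 : sin t / (1 + cos t) = (1 - cos t) / sin t).
  { apply (Rmult_eq_reg_r ((1 + cos t) * sin t)); [|nra]. field_simplify; lra. }
  evar_last.
  { auto_derive; [repeat split; lra|reflexivity]. }
  unfold damping_inv. set (x := exp _).
  transitivity (x * ((1 + beta) / 2 * (sin t / (1 - cos t) + sin t / (1 + cos t))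
                     - beta * (cos t / sin t))).
  { fold x. field. repeat split; lra. }
  rewrite E1, E2. unfold damping_den in *. field. lra.
Qed.

(** All that the phase analysis knows of Y. The interval is symmetric so that 0 is an interior
    point. There the equation itself is singular: y' / [damping_inv] tends to y''(0), so the limit 2
    y''(0) = - w^2 is recorded as [radau_y20]. *)
Record radau_equation (beta w : R) (y y1 y2 : R -> R) : Prop := {
  radau_freq : 0 < w;
  radau_dy : forall t, - PI < t < PI -> is_derive y t (y1 t);
  radau_dy1 : forall t, - PI < t < PI -> is_derive y1 t (y2 t);
  radau_cont_y2 : forall t, - PI < t < PI -> continuous y2 t;
  radau_even : forall t, y (- t) = y t;
  radau_odd : forall t, y1 (- t) = - y1 t;
  radau_y0 : y 0 = 1;
  radau_y10 : y1 0 = 0;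
  radau_y20 : y2 0 = - (w ^ 2 / 2);
  radau_ode : forall t, 0 < t < PI ->
    y2 t = - (y1 t / damping_inv beta t) - w ^ 2 * y t;
  radau_end : continuous y PI /\ y PI = 0
}.

Arguments radau_freq {beta w y y1 y2} _.
Arguments radau_dy {beta w y y1 y2} _.
Arguments radau_dy1 {beta w y y1 y2} _.
Arguments radau_cont_y2 {beta w y y1 y2} _.
Arguments radau_even {beta w y y1 y2} _.
Arguments radau_odd {beta w y y1 y2} _.
Arguments radau_y0 {beta w y y1 y2} _.
Arguments radau_y10 {beta w y y1 y2} _.
Arguments radau_y20 {beta w y y1 y2} _.
Arguments radau_ode {beta w y y1 y2} _.
Arguments radau_end {beta w y y1 y2} _.

(** A nonzero value of [f] would, by the intermediate value theorem, force a value of modulus in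
    [(0, PI]], where the cosine is below 1. *)
Lemma cos_one_lift_zero (f : R -> R) (b : R) :
  continuous_on (fun t => 0 <= t < b) f -> f 0 = 0 ->
  (forall t, 0 <= t < b -> cos (f t) = 1) ->
  forall t, 0 <= t < b -> f t = 0.
Proof.
  intros Hf H0 Hcos t Ht.
  (* Retraction of the line onto [[0, t]]. Being 1-Lipschitz, it turns continuity within [[0, b)]
     into continuity of [f (clamp u)] everywhere, as [IVT_gen] requires. *)
  set (clamp u := Rmax 0 (Rmin u t)).
  assert (Hclamp : forall u, 0 <= clamp u <= t).
  { intros u. unfold clamp, Rmax, Rmin. destruct (Rle_dec u t); destruct (Rle_dec 0 _); lra. }
  assert (Hlip : forall u v, Rabs (clamp u - clamp v) <= Rabs (u - v)).
  { assert (Hspec : forall u, (u <= 0 /\ clamp u = 0) \/ (0 <= u <= t /\ clamp u = u)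
                                \/ (t <= u /\ clamp u = t)).
    { intros u. unfold clamp. destruct (Rle_dec u t).
      - rewrite (Rmin_left u t) by lra.
        destruct (Rle_dec 0 u); [rewrite Rmax_right by lra|rewrite Rmax_left by lra]; lra.
      - rewrite (Rmin_right u t), Rmax_right by lra. lra. }
    intros u v. destruct (Hspec u) as [[? ->]|[[? ->]|[? ->]]];
      destruct (Hspec v) as [[? ->]|[[? ->]|[? ->]]];
      assert (Huv := Rle_abs (u - v)); assert (Hvu := Rle_abs (v - u));
      rewrite Rabs_minus_sym in Hvu; apply Rabs_le; lra. }
  assert (Hcont : continuity (fun u => f (clamp u))).
  { intros u. apply continuity_pt_filterlim.
    assert (Hu := Hclamp u).
    apply (filterlim_comp _ _ _ clamp f (locally u)
             (within (fun t => 0 <= t < b) (locally (clamp u)))).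
    - intros P [d Hd]. exists d. intros v Hv.
      apply Hd; [|assert (Hc := Hclamp v); lra].
      apply (Rle_lt_trans _ (Rabs (v - u))); [apply Hlip|exact Hv].
    - apply Hf. lra. }
  assert (Hend : f (clamp 0) = 0 /\ f (clamp t) = f t).
  { unfold clamp. rewrite Rmin_left, Rmax_left, Rmin_left, Rmax_right by lra.
    split; [exact H0|reflexivity]. }
  destruct Hend as [Hc0 Hct].
  assert (Hlt1 : forall v, 0 < v <= PI -> cos v <> 1).
  { intros v Hv E. assert (cos v < cos 0) by (apply cos_decreasing_1; lra).
    rewrite cos_0 in *. lra. }
  assert (Hpi := PI_RGT_0).
  destruct (Rtotal_order (f t) 0) as [Hneg|[Hz|Hpos]]; [exfalso|exact Hz|exfalso].
  - assert (H1 := Rmax_l (f t) (- PI)). assert (H2 := Rmax_r (f t) (- PI)).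
    assert (H3 : Rmax (f t) (- PI) < 0) by (apply Rmax_lub_lt; lra).
    destruct (IVT_gen (fun u => f (clamp u)) 0 t (Rmax (f t) (- PI)) Hcont) as [x [_ Hx]].
    { rewrite Hc0, Hct, (Rmin_right 0 (f t)), (Rmax_left 0 (f t)) by lra. lra. }
    apply (Hlt1 (- Rmax (f t) (- PI))); [lra|].
    rewrite cos_neg, <- Hx. apply Hcos. assert (Hc := Hclamp x). lra.
  - assert (H1 := Rmin_l (f t) PI). assert (H2 := Rmin_r (f t) PI).
    assert (H3 : 0 < Rmin (f t) PI) by (apply Rmin_pos; lra).
    destruct (IVT_gen (fun u => f (clamp u)) 0 t (Rmin (f t) PI) Hcont) as [x [_ Hx]].
    { rewrite Hc0, Hct, (Rmin_left 0 (f t)), (Rmax_right 0 (f t)) by lra. lra. }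
    apply (Hlt1 (Rmin (f t) PI)); [lra|].
    rewrite <- Hx. apply Hcos. assert (Hc := Hclamp x). lra.
Qed.

(* [r2] is the square of the amplitude. *)
Record prufer_system (beta w : R) (phi r2 : R -> R) : Prop := {
  prufer_freq : 0 < w;
  prufer_phi0 : phi 0 = 0;
  prufer_dphi0 : is_derive phi 0 (w / 2);
  prufer_dphi : forall t, 0 < t < PI ->
    is_derive phi t (w - sin (phi t) * cos (phi t) / damping_inv beta t);
  prufer_dphi_pos : forall t, 0 < t < PI ->
    0 < w - sin (phi t) * cos (phi t) / damping_inv beta t;
  prufer_r2_pos : forall t, 0 <= t < PI -> 0 < r2 t;
  prufer_r20 : r2 0 = 1;
  prufer_r2_cont : continuous r2 0;
  prufer_dr2 : forall t, 0 < t < PI ->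
    is_derive r2 t (- (2 * r2 t * sin (phi t) ^ 2 / damping_inv beta t));
  prufer_osc : forall t0 k, 0 < t0 < PI -> 0 < k ->
    exists t, t0 <= t < PI /\ Rabs (cos (phi t)) < k
}.

Arguments prufer_freq {beta w phi r2} _.
Arguments prufer_phi0 {beta w phi r2} _.
Arguments prufer_dphi0 {beta w phi r2} _.
Arguments prufer_dphi {beta w phi r2} _.
Arguments prufer_dphi_pos {beta w phi r2} _.
Arguments prufer_r2_pos {beta w phi r2} _.
Arguments prufer_r20 {beta w phi r2} _.
Arguments prufer_r2_cont {beta w phi r2} _.
Arguments prufer_dr2 {beta w phi r2} _.
Arguments prufer_osc {beta w phi r2} _.

(** * Energy, monotonicity and phase of a single solution *)

Section PruferPhase.

Variables (beta w : R) (y y1 y2 : R -> R).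
Hypothesis beta_ge : - (1 / 3) <= beta.
Hypothesis Hy : radau_equation beta w y y1 y2.

Definition energy (t : R) : R := w ^ 2 * y t ^ 2 + y1 t ^ 2.

(* [turning] is a positive multiple of the derivative of the phase. *)
Definition turning (t : R) : R := y1 t ^ 2 - y t * y2 t.

Lemma energy_even t : energy (- t) = energy t.
Proof. unfold energy. rewrite (radau_even Hy), (radau_odd Hy). ring. Qed.

Lemma continuous_radau t : - PI < t < PI ->
  continuous y t /\ continuous y1 t /\ continuous y2 t.
Proof.
  intros Ht. repeat split.
  - exact (is_derive_continuous _ _ _ (radau_dy Hy t Ht)).
  - exact (is_derive_continuous _ _ _ (radau_dy1 Hy t Ht)).
  - exact (radau_cont_y2 Hy t Ht).
Qed.

Lemma continuous_energy t : - PI < t < PI -> continuous energy t.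
Proof.
  intros Ht. destruct (continuous_radau t Ht) as (H0 & H1 & _).
  apply (continuous_plus (fun u => w ^ 2 * y u ^ 2)).
  - apply (continuous_mult (fun _ => w ^ 2)); [apply continuous_const|].
    apply continuous_sqr, H0.
  - apply continuous_sqr, H1.
Qed.

Lemma continuous_turning t : - PI < t < PI -> continuous turning t.
Proof.
  intros Ht. destruct (continuous_radau t Ht) as (H0 & H1 & H2).
  apply (continuous_minus (fun u => y1 u ^ 2)).
  - apply continuous_sqr, H1.
  - apply (continuous_mult y y2); assumption.
Qed.

Lemma is_derive_energy t : 0 < t < PI ->
  is_derive energy t (- (2 * y1 t ^ 2 / damping_inv beta t)).
Proof.
  intros Ht. assert (Ht' : - PI < t < PI) by lra.
  assert (D0 := radau_dy Hy t Ht').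
  assert (D1 := radau_dy1 Hy t Ht').
  assert (E := radau_ode Hy t Ht).
  unfold energy. evar_last.
  { auto_derive; [repeat split; eexists; eassumption|reflexivity]. }
  replace (Derive _ t) with (y1 t) by (symmetry; apply is_derive_unique, D0).
  replace (Derive _ t) with (y2 t) by (symmetry; apply is_derive_unique, D1).
  rewrite E. assert (Hg := damping_inv_pos beta t beta_ge Ht). field. lra.
Qed.

Lemma energy_0 : energy 0 = w ^ 2.
Proof. unfold energy. rewrite (radau_y0 Hy), (radau_y10 Hy). ring. Qed.

Lemma energy_nonneg t : 0 <= energy t.
Proof. unfold energy. nra. Qed.

(** The energy decreases, which does not exclude a zero; but [p ^ 2 * energy] is nondecreasing for
    the integrating factor [p]. A zero at [t] would therefore annihilate the energy on [(0, t)],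
    against [energy 0 = w ^ 2]. *)
Lemma energy_pos_right t : 0 <= t < PI -> 0 < energy t.
Proof.
  intros Ht. assert (Hw := radau_freq Hy).
  destruct (Req_dec t 0) as [->|Ht0]; [rewrite energy_0; nra|].
  destruct (energy_nonneg t) as [H|H]; [exact H|exfalso].
  destruct (damping_integrating_factor beta beta_ge) as [p Hp].
  assert (Hz : forall u, 0 < u < t -> energy u = 0).
  { intros u Hu. assert (Hle : p u ^ 2 * energy u <= p t ^ 2 * energy t).
    { apply (nonneg_derive_le (fun v => p v ^ 2 * energy v)
        (fun v => 2 * p v ^ 2 * w ^ 2 * y v ^ 2 / damping_inv beta v) 0 PI); try lra.
      - intros v Hv. destruct (Hp v Hv) as [Hpv Dp].
        assert (De := is_derive_energy v Hv).
        assert (Hg := damping_inv_pos beta v beta_ge Hv).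
        evar_last.
        { auto_derive; [repeat split; eexists; eassumption|reflexivity]. }
        replace (Derive _ v) with (p v / damping_inv beta v)
          by (symmetry; apply is_derive_unique, Dp).
        replace (Derive _ v) with (- (2 * y1 v ^ 2 / damping_inv beta v))
          by (symmetry; apply is_derive_unique, De).
        unfold energy. field. lra.
      - intros v Hv. assert (Hg : 0 < damping_inv beta v)
          by (apply damping_inv_pos; [exact beta_ge|lra]).
        apply Rdiv_le_0_compat; [|exact Hg].
        assert (0 <= p v ^ 2) by nra. assert (0 <= w ^ 2) by nra.
        assert (0 <= y v ^ 2) by nra.
        apply Rmult_le_pos; [apply Rmult_le_pos; lra|lra]. }
    rewrite <- H in Hle. destruct (Hp u) as [Hpu _]; [lra|].
    assert (0 < p u ^ 2) by nra. assert (Hn := energy_nonneg u). nra. }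
  destruct (continuous_near energy 0 (w ^ 2)) as [d [Hd Hnear]].
  { apply continuous_energy. assert (H0 := PI_RGT_0). lra. }
  { nra. }
  assert (Hm : 0 < Rmin (d / 2) (t / 2)) by (apply Rmin_pos; lra).
  assert (H1 := Rmin_l (d / 2) (t / 2)). assert (H2 := Rmin_r (d / 2) (t / 2)).
  set (h := Rmin (d / 2) (t / 2)) in *.
  assert (Hh : Rabs (h - 0) < d) by (rewrite Rminus_0_r, Rabs_pos_eq; lra).
  apply Hnear in Hh. rewrite energy_0, Hz in Hh by lra.
  apply Rabs_def2 in Hh. lra.
Qed.

Lemma energy_pos t : - PI < t < PI -> 0 < energy t.
Proof.
  intros Ht. destruct (Rle_lt_dec 0 t) as [H|H]; [apply energy_pos_right; lra|].
  rewrite <- (Ropp_involutive t), energy_even. apply energy_pos_right. lra.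
Qed.

(* [y * y1 >= - c * y ^ 2] makes [exp (2 * c * t) * y ^ 2] nondecreasing, although
   [y] vanishes at PI. *)
Lemma log_derivative_unbounded (t0 c : R) : 0 < t0 < PI -> y t0 <> 0 -> 0 <= c ->
  ~ (forall t, t0 <= t < PI -> - c * y t ^ 2 <= y t * y1 t).
Proof.
  intros Ht0 Hy0 Hc Hle.
  assert (Hmono : forall t, t0 <= t < PI ->
    exp (2 * c * t0) * y t0 ^ 2 <= exp (2 * c * t) * y t ^ 2).
  { intros t Ht.
    destruct (Req_dec t t0) as [->|Hne]; [lra|].
    apply (nonneg_derive_le (fun v => exp (2 * c * v) * y v ^ 2)
      (fun v => exp (2 * c * v) * 2 * (c * y v ^ 2 + y v * y1 v)) 0 PI); try lra.
    - intros v Hv. assert (D := radau_dy Hy v ltac:(lra)).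
      evar_last.
      { auto_derive; [repeat split; eexists; eassumption|reflexivity]. }
      replace (Derive _ v) with (y1 v) by (symmetry; apply is_derive_unique, D). ring.
    - intros v Hv. specialize (Hle v ltac:(lra)).
      assert (He := exp_pos (2 * c * v)). apply Rmult_le_pos; lra. }
  destruct (radau_end Hy) as [Hcont Hend].
  (* By monotonicity [y ^ 2] stays at or above [k] on [[t0, PI)], while it tends to 0 at [PI]. *)
  set (k := exp (2 * c * t0) * y t0 ^ 2 / exp (2 * c * PI)).
  assert (Hk : 0 < k).
  { apply Rdiv_lt_0_compat; [|apply exp_pos].
    apply Rmult_lt_0_compat; [apply exp_pos|]. nra. }
  destruct (continuous_near (fun u => y u ^ 2) PI k (continuous_sqr y PI Hcont) Hk)
    as [d [Hd Hnear]].
  assert (Hm : 0 < Rmin (d / 2) (PI - t0)) by (apply Rmin_pos; lra).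
  assert (H1 := Rmin_l (d / 2) (PI - t0)). assert (H2 := Rmin_r (d / 2) (PI - t0)).
  set (h := Rmin (d / 2) (PI - t0)) in *.
  assert (Hh : Rabs (PI - h - PI) < d).
  { replace (PI - h - PI) with (- h) by ring. rewrite Rabs_Ropp, Rabs_pos_eq; lra. }
  apply Hnear in Hh. rewrite Hend in Hh. apply Rabs_def2 in Hh.
  specialize (Hmono (PI - h) ltac:(lra)).
  assert (He : exp (2 * c * (PI - h)) <= exp (2 * c * PI)).
  { destruct (Req_dec c 0) as [->|]; [right; f_equal; ring|].
    left. apply exp_increasing. nra. }
  assert (Hlt : exp (2 * c * PI) * y (PI - h) ^ 2 < exp (2 * c * t0) * y t0 ^ 2).
  { replace (exp (2 * c * t0) * y t0 ^ 2) with (exp (2 * c * PI) * k).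
    - apply Rmult_lt_compat_l; [apply exp_pos|lra].
    - unfold k. field. apply Rgt_not_eq, exp_pos. }
  assert (0 <= y (PI - h) ^ 2) by nra. nra.
Qed.

Lemma turning_0 : turning 0 = w ^ 2 / 2.
Proof.
  unfold turning.
  rewrite (radau_y0 Hy), (radau_y10 Hy), (radau_y20 Hy). ring.
Qed.

Lemma turning_eq t : 0 < t < PI ->
  turning t * damping_inv beta t = damping_inv beta t * energy t + y t * y1 t.
Proof.
  intros Ht. unfold turning, energy. rewrite (radau_ode Hy t Ht).
  assert (Hg := damping_inv_pos beta t beta_ge Ht). field. lra.
Qed.

(* The derivative of [p * damping_inv * turning] has the sign of [damping_inv'],
   which changes only once. *)
Lemma is_derive_turning p t : 0 < t < PI ->
  0 < p t -> is_derive p t (p t / damping_inv beta t) ->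
  is_derive (fun u => p u * (damping_inv beta u * energy u + y u * y1 u)) t
    (p t * damping_inv' beta t * energy t).
Proof.
  intros Ht Hpt Dp. assert (Ht' : - PI < t < PI) by lra.
  assert (D0 := radau_dy Hy t Ht').
  assert (D1 := radau_dy1 Hy t Ht').
  assert (De := is_derive_energy t Ht).
  assert (Dg := is_derive_damping_inv beta t beta_ge).
  assert (Hg := damping_inv_pos beta t beta_ge Ht).
  evar_last.
  { auto_derive; [repeat split; eexists; eassumption|reflexivity]. }
  replace (Derive (fun _ => p _) t) with (p t / damping_inv beta t)
    by (symmetry; apply is_derive_unique, Dp).
  replace (Derive (fun _ => energy _) t) with (- (2 * y1 t ^ 2 / damping_inv beta t))
    by (symmetry; apply is_derive_unique, De).
  replace (Derive (fun _ => damping_inv beta _) t) with (damping_inv' beta t)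
    by (symmetry; apply is_derive_unique, Dg).
  replace (Derive (fun _ => y _) t) with (y1 t) by (symmetry; apply is_derive_unique, D0).
  replace (Derive (fun _ => y1 _) t) with (y2 t) by (symmetry; apply is_derive_unique, D1).
  rewrite (radau_ode Hy t Ht). unfold energy. field. lra.
Qed.

Lemma damping_inv'_sign t :
  (0 < (1 + beta) * cos t - beta -> 0 < damping_inv' beta t) /\
  ((1 + beta) * cos t - beta <= 0 -> damping_inv' beta t <= 0).
Proof.
  assert (H := damping_den_pos beta t beta_ge).
  assert (H2 : 0 < damping_den beta t ^ 2) by nra.
  unfold damping_inv', Rdiv. apply Rinv_0_lt_compat in H2. split; nra.
Qed.

(** The function [F], which is [p * damping_inv * turning], increases from positive values near 0 as
    long as [damping_inv'] is positive. Afterwards it is nonincreasing, so a nonpositive value would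
    persist up to [PI], and [log_derivative_unbounded] excludes that. *)
Lemma turning_pos t : 0 <= t < PI -> 0 < turning t.
Proof.
  intros Ht. assert (Hw := radau_freq Hy). assert (Hpi := PI_RGT_0).
  destruct (Req_dec t 0) as [->|Ht0]; [rewrite turning_0; nra|].
  destruct (damping_integrating_factor beta beta_ge) as [p Hp].
  set (F u := p u * (damping_inv beta u * energy u + y u * y1 u)).
  assert (HF : forall u, 0 < u < PI -> F u = p u * damping_inv beta u * turning u).
  { intros u Hu. unfold F. rewrite <- (turning_eq u Hu). ring. }
  assert (HP : forall u, 0 < u < PI -> 0 < p u * damping_inv beta u).
  { intros u Hu. apply Rmult_lt_0_compat; [apply Hp, Hu|].
    apply damping_inv_pos; assumption. }
  assert (DF : forall u, 0 < u < PI ->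
    is_derive F u (p u * damping_inv' beta u * energy u)).
  { intros u Hu. destruct (Hp u Hu). apply is_derive_turning; assumption. }
  apply Rnot_le_lt. intros Hneg.
  destruct (Rlt_le_dec 0 ((1 + beta) * cos t - beta)) as [Hinc|Hdec].
  - destruct (continuous_near turning 0 (w ^ 2 / 2)) as [d [Hd Hnear]].
    { apply continuous_turning. lra. }
    { nra. }
    assert (Hm : 0 < Rmin (d / 2) (t / 2)) by (apply Rmin_pos; lra).
    assert (H1 := Rmin_l (d / 2) (t / 2)). assert (H2 := Rmin_r (d / 2) (t / 2)).
    set (h := Rmin (d / 2) (t / 2)) in *.
    assert (Hh : Rabs (h - 0) < d) by (rewrite Rminus_0_r, Rabs_pos_eq; lra).
    apply Hnear in Hh. rewrite turning_0 in Hh. apply Rabs_def2 in Hh.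
    assert (Hle : F h <= F t).
    { apply (nonneg_derive_le F _ 0 PI h t DF); try lra.
      intros u Hu. apply Rmult_le_pos; [apply Rmult_le_pos|apply energy_nonneg].
      - left. apply Hp. lra.
      - left. apply damping_inv'_sign.
        assert (cos t < cos u) by (apply cos_decreasing_1; lra).
        assert (0 < 1 + beta) by lra. nra. }
    rewrite !HF in Hle by lra.
    assert (HPh := HP h ltac:(lra)). assert (HPt := HP t ltac:(lra)). nra.
  - assert (Hle : forall u, t <= u < PI -> turning u <= 0).
    { intros u Hu. assert (Hle : - F t <= - F u).
      { apply (nonneg_derive_le (fun v => - F v)
          (fun v => - (p v * damping_inv' beta v * energy v)) 0 PI t u); try lra.
        - intros v Hv. apply (is_derive_opp F). apply DF, Hv.
        - intros v Hv.
          assert (damping_inv' beta v <= 0).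
          { apply damping_inv'_sign.
            assert (cos v < cos t) by (apply cos_decreasing_1; lra).
            assert (0 < 1 + beta) by lra. nra. }
          assert (0 < p v) by (apply Hp; lra). assert (He := energy_nonneg v).
          assert (0 <= p v * - damping_inv' beta v) by (apply Rmult_le_pos; lra).
          nra. }
      rewrite !HF in Hle by lra.
      assert (HPu := HP u ltac:(lra)). assert (HPt := HP t ltac:(lra)). nra. }
    assert (Hyy : forall u, t <= u < PI -> y u * y1 u < 0).
    { intros u Hu. assert (E := turning_eq u ltac:(lra)). specialize (Hle u Hu).
      assert (Hg := damping_inv_pos beta u beta_ge ltac:(lra)).
      assert (He := energy_pos u ltac:(lra)). nra. }
    assert (Hy0 : forall u, t <= u < PI -> y u <> 0).
    { intros u Hu E. specialize (Hyy u Hu). rewrite E in Hyy. lra. }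
    (* Where [turning] is nonpositive, [y1 / y] is nondecreasing, its derivative being
       [- turning / y ^ 2]; hence its value at [t] bounds it from below up to [PI]. *)
    set (c := - (y1 t / y t)).
    apply (log_derivative_unbounded t c); [lra|apply Hy0; lra| |].
    + unfold c. specialize (Hyy t ltac:(lra)). specialize (Hy0 t ltac:(lra)).
      replace (- (y1 t / y t)) with (- (y t * y1 t) / y t ^ 2) by (field; assumption).
      apply Rdiv_le_0_compat; nra.
    + intros u Hu.
      assert (Hc : y1 t / y t <= y1 u / y u).
      { destruct (Req_dec u t) as [->|]; [lra|].
        destruct (MVT_cor2 (fun v => y1 v / y v) (fun v => - turning v / y v ^ 2) t u)
          as [v [Hv Hvr]]; [lra| |].
        - intros v Hv. apply is_derive_Reals.
          assert (D0 := radau_dy Hy v ltac:(lra)).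
          assert (D1 := radau_dy1 Hy v ltac:(lra)).
          specialize (Hy0 v ltac:(lra)).
          evar_last.
          { auto_derive; [repeat split; [eexists; eassumption..|exact Hy0]|reflexivity]. }
          replace (Derive (fun _ => y _) v) with (y1 v)
            by (symmetry; apply is_derive_unique, D0).
          replace (Derive (fun _ => y1 _) v) with (y2 v)
            by (symmetry; apply is_derive_unique, D1).
          unfold turning. field. exact Hy0.
        - specialize (Hle v ltac:(lra)). specialize (Hy0 v ltac:(lra)).
          assert (0 <= - turning v / y v ^ 2) by (apply Rdiv_le_0_compat; nra).
          nra. }
      unfold c. specialize (Hy0 u Hu).
      replace (y u * y1 u) with (y1 u / y u * y u ^ 2) by (field; assumption).
      nra.
Qed.

(** The derivative of minus the argument of w y + i y'. It is free of the phase and continuous on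
    [(- PI, PI)], so the phase is a plain integral; [phase_speed_eq] recovers the usual form away
    from 0. *)
Definition phase_speed (t : R) : R := w * turning t / energy t.
Definition phase_int (t : R) : R := RInt phase_speed 0 t.

Lemma continuous_phase_speed t : - PI < t < PI -> continuous phase_speed t.
Proof.
  intros Ht.
  assert (HE := energy_pos t Ht).
  apply (continuous_mult (fun u => w * turning u)).
  - apply (continuous_mult (fun _ => w)); [apply continuous_const|].
    exact (continuous_turning t Ht).
  - apply (continuous_comp energy Rinv).
    + exact (continuous_energy t Ht).
    + apply continuous_Rinv. lra.
Qed.

Lemma is_derive_phase_int t : - PI < t < PI -> is_derive phase_int t (phase_speed t).
Proof.
  intros Ht. apply (is_derive_RInt phase_speed phase_int 0 t).
  - assert (Hd : 0 < Rmin (t + PI) (PI - t)) by (apply Rmin_pos; lra).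
    exists (mkposreal _ Hd). intros v Hv. change (Rabs (v - t) < Rmin (t + PI) (PI - t)) in Hv.
    assert (H1 := Rmin_l (t + PI) (PI - t)). assert (H2 := Rmin_r (t + PI) (PI - t)).
    apply Rabs_def2 in Hv.
    apply (RInt_correct phase_speed 0 v).
    apply ex_RInt_continuous. intros z Hz. apply continuous_phase_speed.
    unfold Rmin, Rmax in Hz. destruct (Rle_dec 0 v); lra.
  - apply continuous_phase_speed, Ht.
Qed.

Lemma phase_int_0 : phase_int 0 = 0.
Proof. exact (RInt_point 0 phase_speed). Qed.

Lemma is_derive_energy_raw t : - PI < t < PI ->
  is_derive energy t (2 * (w ^ 2 * y t * y1 t + y1 t * y2 t)).
Proof.
  intros Ht.
  assert (D0 := radau_dy Hy t Ht).
  assert (D1 := radau_dy1 Hy t Ht).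
  unfold energy. evar_last.
  { auto_derive; [repeat split; eexists; eassumption|reflexivity]. }
  replace (Derive (fun _ => y _) t) with (y1 t) by (symmetry; apply is_derive_unique, D0).
  replace (Derive (fun _ => y1 _) t) with (y2 t) by (symmetry; apply is_derive_unique, D1).
  ring.
Qed.

(* (w y + i y') exp (i phi) / |w y + i y'| is constant. *)
Lemma phase_int_rotation c t : - PI < t < PI ->
  is_derive (fun u => (w * y u * cos (phase_int u + c) - y1 u * sin (phase_int u + c))
                      / sqrt (energy u)) t 0.
Proof.
  intros Ht.
  assert (D0 := radau_dy Hy t Ht).
  assert (D1 := radau_dy1 Hy t Ht).
  assert (DE := is_derive_energy_raw t Ht).
  assert (Dp := is_derive_phase_int t Ht).
  assert (HE := energy_pos t Ht).
  assert (Hq := sqrt_lt_R0 _ HE).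
  assert (Hqq : sqrt (energy t) * sqrt (energy t) = w ^ 2 * y t ^ 2 + y1 t ^ 2).
  { apply sqrt_def. left. exact HE. }
  evar_last.
  { auto_derive.
    - repeat split; [eexists; eassumption..|exact HE|apply Rgt_not_eq, Hq].
    - reflexivity. }
  replace (Derive (fun _ => y _) t) with (y1 t) by (symmetry; apply is_derive_unique, D0).
  replace (Derive (fun _ => y1 _) t) with (y2 t) by (symmetry; apply is_derive_unique, D1).
  replace (Derive (fun _ => phase_int _) t) with (phase_speed t)
    by (symmetry; apply is_derive_unique, Dp).
  replace (Derive (fun _ => energy _) t) with (2 * (w ^ 2 * y t * y1 t + y1 t * y2 t))
    by (symmetry; apply is_derive_unique, DE).
  (* [a] is the derivative of the numerator, and [e] is the numerator times half the derivative of
     [energy]. Grouped this way, the square root enters the bracket only through its square. *)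
  set (a := w * y1 t * cos (phase_int t + c) - w * y t * sin (phase_int t + c) * phase_speed t
            - y2 t * sin (phase_int t + c) - y1 t * cos (phase_int t + c) * phase_speed t).
  set (e := (w ^ 2 * y t * y1 t + y1 t * y2 t)
            * (w * y t * cos (phase_int t + c) - y1 t * sin (phase_int t + c))).
  transitivity ((a - e / (sqrt (energy t) * sqrt (energy t))) / sqrt (energy t)).
  - unfold a, e. field. lra.
  - rewrite Hqq. replace (a - _) with 0; [unfold Rdiv; ring|].
    unfold a, e, phase_speed, turning, energy in *. field. lra.
Qed.

Lemma zero_derive_const (f : R -> R) t :
  0 <= t < PI -> (forall u, - PI < u < PI -> is_derive f u 0) -> f t = f 0.
Proof.
  intros [[Ht|Ht] Htpi] Hf; [|rewrite Ht; reflexivity].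
  symmetry. apply (eq_is_derive f 0 t); [|exact Ht].
  intros u Hu. apply Hf. assert (H := PI_RGT_0). lra.
Qed.

Lemma phase_int_lift t : 0 <= t < PI ->
  w * y t = sqrt (energy t) * cos (phase_int t) /\
  y1 t = - (sqrt (energy t) * sin (phase_int t)).
Proof.
  intros Ht. assert (Hw := radau_freq Hy).
  assert (HE := energy_pos_right t Ht).
  assert (Hq := sqrt_lt_R0 _ HE).
  (* The shifts 0 and [- (PI / 2)] give the real and the imaginary part of the constant, which are 1
     and 0 by the values at 0. Rotating back by the phase yields the two claims. *)
  assert (HU := zero_derive_const _ t Ht (phase_int_rotation 0)).
  assert (HV := zero_derive_const _ t Ht (phase_int_rotation (- (PI / 2)))).
  simpl in HU, HV.
  rewrite phase_int_0, energy_0, (radau_y0 Hy), (radau_y10 Hy), sqrt_pow2 in HU, HV by lra.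
  rewrite !Rplus_0_r, cos_0, sin_0 in HU.
  rewrite Rplus_0_l, cos_plus, sin_plus, !cos_neg, !sin_neg, cos_PI2, sin_PI2 in HV.
  set (q := sqrt (energy t)) in *. set (c := cos (phase_int t)) in *.
  set (s := sin (phase_int t)) in *.
  assert (HU' : w * y t * c - y1 t * s = q).
  { replace (w * y t * c - y1 t * s) with ((w * y t * c - y1 t * s) / q * q) by (field; lra).
    rewrite HU. field. lra. }
  assert (HV' : w * y t * s + y1 t * c = 0).
  { match type of HV with ?l = ?r => assert (E : l * q = r * q) by (rewrite HV; reflexivity) end.
    field_simplify in E; lra. }
  assert (Hcs : s * s + c * c = 1).
  { assert (H := sin2_cos2 (phase_int t)). unfold Rsqr in H. exact H. }
  split.
  - rewrite <- HU'. transitivity (w * y t * (s * s + c * c) ); [rewrite Hcs; ring|].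
    transitivity ((w * y t * c - y1 t * s) * c + s * (w * y t * s + y1 t * c)); [ring|].
    rewrite HV'. ring.
  - rewrite <- HU'. transitivity (y1 t * (s * s + c * c) ); [rewrite Hcs; ring|].
    transitivity (- ((w * y t * c - y1 t * s) * s) + c * (w * y t * s + y1 t * c)); [ring|].
    rewrite HV'. ring.
Qed.

(** Two lifts of the same direction differ by a continuous function that vanishes at 0 and whose
    cosine is 1. This is what identifies a phase chosen by [epsilon], of which only the
    specification is known. *)
Lemma phase_int_unique (phi : R -> R) :
  continuous_on (fun t => 0 <= t < PI) phi -> phi 0 = 0 ->
  (forall t, 0 <= t < PI ->
    w * y t = sqrt (energy t) * cos (phi t) /\ y1 t = - (sqrt (energy t) * sin (phi t))) ->
  forall t, 0 <= t < PI -> phi t = phase_int t.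
Proof.
  intros Hc H0 Hphi t Ht.
  assert (phi t - phase_int t = 0); [|lra].
  apply (cos_one_lift_zero (fun u => phi u - phase_int u) PI); [| | |exact Ht].
  - intros u Hu.
    assert (Hm : continuous_on (fun t => 0 <= t < PI) phase_int).
    { apply continuous_on_forall. intros v Hv.
      refine (is_derive_continuous _ _ _ (is_derive_phase_int v _)).
      assert (H := PI_RGT_0). split; [apply Rlt_le_trans with 0; [lra|apply Hv]|apply Hv]. }
    apply (filterlim_comp_2 (G := locally (phi u)) (H := locally (opp (phase_int u)))
             phi (fun v => opp (phase_int v)) plus).
    + exact (Hc u Hu).
    + apply (filterlim_comp _ _ _ phase_int opp _ (locally (phase_int u))).
      * exact (Hm u Hu).
      * apply (filterlim_opp (phase_int u)).
    + apply (filterlim_plus (phi u) (opp (phase_int u))).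
  - rewrite H0, phase_int_0. ring.
  - intros u Hu. destruct (Hphi u Hu) as [Ec Es].
    destruct (phase_int_lift u Hu) as [Ec' Es'].
    assert (HE := energy_pos_right u Hu).
    assert (Hq := sqrt_lt_R0 _ HE).
    assert (Hcc : cos (phi u) = cos (phase_int u)).
    { apply (Rmult_eq_reg_l (sqrt (energy u))); lra. }
    assert (Hss : sin (phi u) = sin (phase_int u)).
    { apply (Rmult_eq_reg_l (sqrt (energy u))); lra. }
    rewrite cos_minus, Hcc, Hss. assert (H := sin2_cos2 (phase_int u)).
    unfold Rsqr in H. lra.
Qed.

Lemma phase_speed_pos t : 0 <= t < PI -> 0 < phase_speed t.
Proof.
  intros Ht. apply Rdiv_lt_0_compat.
  - apply Rmult_lt_0_compat; [exact (radau_freq Hy)|].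
    exact (turning_pos t Ht).
  - exact (energy_pos_right t Ht).
Qed.

Lemma phase_speed_eq t : 0 < t < PI ->
  phase_speed t = w - sin (phase_int t) * cos (phase_int t) / damping_inv beta t.
Proof.
  intros Ht. destruct (phase_int_lift t ltac:(lra)) as [Ec Es].
  assert (Hw := radau_freq Hy).
  assert (HE := energy_pos_right t ltac:(lra)).
  assert (Hq := sqrt_lt_R0 _ HE).
  assert (Hqq : sqrt (energy t) * sqrt (energy t) = energy t) by (apply sqrt_def; lra).
  assert (Hg := damping_inv_pos beta t beta_ge Ht).
  assert (Ht' := turning_eq t Ht).
  unfold phase_speed.
  replace (turning t) with (energy t + y t * y1 t / damping_inv beta t).
  - replace (y t) with (sqrt (energy t) * cos (phase_int t) / w) by (rewrite <- Ec; field; lra).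
    rewrite Es. set (q := sqrt (energy t)) in *. rewrite <- Hqq. field. lra.
  - apply (Rmult_eq_reg_r (damping_inv beta t)); [|lra]. rewrite Ht'. field. lra.
Qed.

Lemma prufer_system_phase_int :
  prufer_system beta w phase_int (fun t => y t ^ 2 + y1 t ^ 2 / w ^ 2).
Proof.
  assert (Hw := radau_freq Hy). assert (Hpi := PI_RGT_0).
  assert (Hr : forall t, y t ^ 2 + y1 t ^ 2 / w ^ 2 = / w ^ 2 * energy t).
  { intros t. unfold energy. field. lra. }
  assert (Hw2 : 0 < / w ^ 2) by (apply Rinv_0_lt_compat; nra).
  constructor.
  - exact Hw.
  - exact phase_int_0.
  - replace (w / 2) with (phase_speed 0); [apply is_derive_phase_int; lra|].
    unfold phase_speed. rewrite (turning_0), (energy_0). field. lra.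
  - intros t Ht. rewrite <- phase_speed_eq by exact Ht. apply is_derive_phase_int. lra.
  - intros t Ht. rewrite <- phase_speed_eq by exact Ht. apply phase_speed_pos. lra.
  - intros t Ht. rewrite Hr. apply Rmult_lt_0_compat; [exact Hw2|].
    exact (energy_pos_right t Ht).
  - rewrite Hr, (energy_0). field. lra.
  - apply (continuous_ext (fun t => mult (/ w ^ 2) (energy t))); [intros t; symmetry; apply Hr|].
    apply (continuous_mult (fun _ => / w ^ 2)); [apply continuous_const|].
    apply (continuous_energy). lra.
  - intros t Ht. destruct (phase_int_lift t ltac:(lra)) as [Ec Es].
    assert (HE := energy_pos_right t ltac:(lra)).
    assert (Hqq : sqrt (energy t) * sqrt (energy t) = energy t) by (apply sqrt_def; lra).
    assert (Hg := damping_inv_pos beta t beta_ge Ht).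
    apply (is_derive_ext (fun t => / w ^ 2 * energy t)); [intros u; symmetry; apply Hr|].
    rewrite Hr.
    replace (- (2 * (/ w ^ 2 * energy t) * sin (phase_int t) ^ 2 / damping_inv beta t))
      with (/ w ^ 2 * - (2 * y1 t ^ 2 / damping_inv beta t)).
    + apply (is_derive_scal energy t (/ w ^ 2)).
      exact (is_derive_energy t Ht).
    + rewrite Es. set (q := sqrt (energy t)) in *. rewrite <- Hqq. field. lra.
  - intros t0 k Ht0 Hk.
    destruct (classic (exists t, t0 <= t < PI /\ Rabs (cos (phase_int t)) < k))
      as [H|H]; [exact H|exfalso].
    assert (Hcos : forall t, t0 <= t < PI -> k <= Rabs (cos (phase_int t))).
    { intros t Ht. apply Rnot_lt_le. intros Hlt. apply H. exists t. split; assumption. }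
    (* If the cosine had modulus at least [k] up to [PI], then |y'| = w |tan phi| |y| would be at
       most [w / k] times |y|. *)
    apply (log_derivative_unbounded t0 (w / k)); [exact Ht0| | |].
    + intros E. destruct (phase_int_lift t0 ltac:(lra)) as [Ec _].
      assert (HE := energy_pos_right t0 ltac:(lra)).
      assert (Hq := sqrt_lt_R0 _ HE).
      rewrite E in Ec. assert (Hz : cos (phase_int t0) = 0).
      { apply (Rmult_eq_reg_l (sqrt (energy t0))); lra. }
      specialize (Hcos t0 ltac:(lra)). rewrite Hz, Rabs_R0 in Hcos. lra.
    + left. apply Rdiv_lt_0_compat; assumption.
    + intros t Ht. destruct (phase_int_lift t ltac:(lra)) as [Ec Es].
      specialize (Hcos t Ht).
      set (q := sqrt (energy t)) in *. set (c := cos (phase_int t)) in *.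
      set (s := sin (phase_int t)) in *.
      assert (Hs : -1 <= s <= 1) by apply SIN_bound.
      replace (y t) with (q * c / w) by (rewrite <- Ec; field; lra). rewrite Es.
      replace (- (w / k) * (q * c / w) ^ 2) with (/ (w * k) * q ^ 2 * - (c ^ 2))
        by (field; lra).
      replace (q * c / w * - (q * s)) with (/ (w * k) * q ^ 2 * - (k * (c * s)))
        by (field; lra).
      apply Rmult_le_compat_l.
      * apply Rmult_le_pos; [|nra]. left. apply Rinv_0_lt_compat. nra.
      * apply Ropp_le_contravar.
        apply (Rle_trans _ (k * Rabs c)).
        -- apply Rmult_le_compat_l; [lra|]. unfold Rabs. destruct (Rcase_abs c); nra.
        -- rewrite <- (pow2_abs c). nra.
Qed.

End PruferPhase.

(** * Comparison of two phases *)

Section OnePhase.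

Variables (beta w : R) (phi r2 : R -> R).
Hypothesis beta_ge : - (1 / 3) <= beta.
Hypothesis Hsys : prufer_system beta w phi r2.

(** [Derive phi] covers both the value [w / 2] at 0 and the formula with [damping_inv], which is
    meaningful only for [t > 0]. *)
Lemma prufer_Derive_pos t : 0 <= t < PI ->
  is_derive phi t (Derive phi t) /\ 0 < Derive phi t.
Proof.
  intros [[Ht|Ht] Hpi].
  - assert (D := prufer_dphi Hsys t (conj Ht Hpi)).
    assert (P := prufer_dphi_pos Hsys t (conj Ht Hpi)).
    rewrite (is_derive_unique _ _ _ D). split; assumption.
  - subst t. assert (D := prufer_dphi0 Hsys).
    assert (P := prufer_freq Hsys).
    rewrite (is_derive_unique _ _ _ D). split; [assumption|lra].
Qed.

Lemma prufer_incr x y : 0 <= x -> x < y -> y < PI -> phi x < phi y.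
Proof.
  intros Hx Hxy Hy.
  destruct (MVT_cor2 phi (Derive phi) x y Hxy) as [c [Hc Hcr]].
  - intros c Hc. apply is_derive_Reals, prufer_Derive_pos. lra.
  - destruct (prufer_Derive_pos c) as [_ Hp]; [lra|]. nra.
Qed.

Lemma prufer_lt_inv x y : 0 <= y -> x < PI -> phi x < phi y -> x < y.
Proof.
  intros Hy Hx H. apply Rnot_le_lt. intros [Hlt|Heq].
  - assert (phi y < phi x) by (apply prufer_incr; lra). lra.
  - subst. lra.
Qed.

Lemma prufer_continuous t : 0 <= t < PI -> continuous phi t.
Proof. intros Ht. apply (is_derive_continuous _ _ _ (proj1 (prufer_Derive_pos t Ht))). Qed.

Lemma prufer_phase_onto s t1 : 0 < s -> 0 <= t1 < PI -> s < phi t1 ->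
  exists t, 0 < t < PI /\ phi t = s.
Proof.
  intros Hs Ht1 Hlt. assert (H0 := prufer_phi0 Hsys).
  assert (Hpos : 0 < t1) by (apply (prufer_lt_inv 0 t1); lra).
  destruct (IVT_interv (fun t => phi t - s) 0 t1) as [z [Hz Ez]]; try lra.
  - intros a Ha. apply continuity_pt_minus; [|apply continuity_pt_const; intros ? ?; reflexivity].
    apply continuity_pt_filterlim, prufer_continuous. lra.
  - exists z. assert (z <> 0) by (intros ->; lra). split; lra.
Qed.

(** For an increasing phase this is convergence to [s] at [PI] from strictly below, stated as a
    supremum. *)
Definition phase_tends (s : R) : Prop :=
  (forall t, 0 <= t < PI -> phi t < s) /\
  forall eps, 0 < eps -> exists t, 0 <= t < PI /\ s - eps < phi t.

(** The supremum [l] of the phase lies in [(c, c + PI]]. By monotonicity the phase stays near [l]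
    close to [PI], where by [prufer_osc] its cosine gets arbitrarily small; so [cos l = 0], and
    [c + PI] is the only zero of the cosine in that interval. *)
Lemma phase_tends_of_bounds c t1 : cos c = 0 -> 0 <= t1 < PI -> c <= phi t1 ->
  (forall t, 0 <= t < PI -> phi t < c + PI) -> phase_tends (c + PI).
Proof.
  intros Hc Ht1 Hlow Hup. split; [exact Hup|].
  destruct (completeness (fun v => exists t, 0 <= t < PI /\ v = phi t)) as [l [Hub Hlub]].
  { exists (c + PI). intros v [t [Ht ->]]. left. apply Hup, Ht. }
  { exists (phi t1), t1. split; [exact Ht1|reflexivity]. }
  assert (Hsup : forall eps, 0 < eps -> exists t, 0 <= t < PI /\ l - eps < phi t).
  { intros eps Heps. destruct (classic (exists t, 0 <= t < PI /\ l - eps < phi t))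
      as [H|H]; [exact H|exfalso].
    assert (l <= l - eps); [|lra].
    apply Hlub. intros v [t [Ht ->]]. apply Rnot_lt_le. intros Hlt.
    apply H. exists t. split; assumption. }
  assert (Hlc : l <= c + PI).
  { apply Hlub. intros v [t [Ht ->]]. left. apply Hup, Ht. }
  assert (Hcl : c < l).
  { apply Rle_lt_trans with (phi t1); [exact Hlow|].
    apply Rlt_le_trans with (phi ((t1 + PI) / 2)).
    - apply prufer_incr; lra.
    - apply Hub. exists ((t1 + PI) / 2). split; [lra|reflexivity]. }
  assert (Hcos : cos l = 0).
  { destruct (Req_dec (cos l) 0) as [H|H]; [exact H|exfalso].
    assert (Hk : 0 < Rabs (cos l) / 2) by (assert (Hk := Rabs_pos_lt _ H); lra).
    destruct (continuous_near cos l _ (continuous_cos l) Hk) as [d [Hd Hnear]].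
    destruct (Hsup d Hd) as [t0 [Ht0 Hphi]].
    destruct (prufer_osc Hsys ((t0 + PI) / 2) (Rabs (cos l) / 2))
      as [t [Ht Hlt]]; [lra|exact Hk|].
    assert (phi t0 < phi t) by (apply prufer_incr; lra).
    assert (phi t <= l) by (apply Hub; exists t; split; [lra|reflexivity]).
    assert (Hcl' : Rabs (phi t - l) < d) by (apply Rabs_def1; lra).
    apply Hnear in Hcl'. assert (Htri := Rabs_triang_inv (cos l) (cos (phi t))).
    rewrite Rabs_minus_sym in Hcl'. lra. }
  assert (Hl : l = c + PI).
  { destruct Hlc as [Hlc|Hlc]; [exfalso|exact Hlc].
    assert (Hs : 0 < sin (l - c)) by (apply sin_gt_0; lra).
    replace l with (c + (l - c)) in Hcos by ring.
    rewrite cos_plus, Hc in Hcos. assert (Hcs := sin2_cos2 c). unfold Rsqr in Hcs.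
    rewrite Hc in Hcs. assert (sin c * sin (l - c) = 0) by lra.
    assert (sin c <> 0) by (intros E; rewrite E in Hcs; lra).
    apply Rmult_integral in H as [H|H]; [contradiction|lra]. }
  rewrite <- Hl. exact Hsup.
Qed.

(** * The angle, the stiffness and the amplitude as functions of the phase *)

Section Inverse.

Variables (send : R) (theta : R -> R).
Hypothesis Htheta : forall s, 0 < s < send -> 0 < theta s < PI /\ phi (theta s) = s.

Lemma theta_bounds_near s t1 t2 : 0 < s < send ->
  0 <= t1 < PI -> 0 <= t2 < PI -> phi t1 < s < phi t2 -> t1 < theta s < t2.
Proof.
  intros Hs Ht1 Ht2 H. destruct (Htheta s Hs) as [Hr E].
  split; apply prufer_lt_inv; lra.
Qed.

Lemma theta_limit_0 eps : 0 < eps ->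
  exists d, 0 < d /\ forall s, 0 < s < d -> s < send -> theta s < eps.
Proof.
  intros Heps. assert (Hpi := PI_RGT_0).
  assert (Hm : 0 < Rmin eps (PI / 2)) by (apply Rmin_pos; lra).
  assert (H1 := Rmin_l eps (PI / 2)). assert (H2 := Rmin_r eps (PI / 2)).
  set (t := Rmin eps (PI / 2)) in *.
  assert (Hphi : 0 < phi t).
  { rewrite <- (prufer_phi0 Hsys). apply prufer_incr; lra. }
  exists (phi t). split; [exact Hphi|]. intros s Hs Hse.
  destruct (Htheta s ltac:(lra)) as [Hr E].
  assert (theta s < t); [|lra]. apply prufer_lt_inv; lra.
Qed.

Lemma continuous_theta s : 0 < s < send -> continuous theta s.
Proof.
  intros Hs. destruct (Htheta s Hs) as [Hr E].
  apply (proj2 (filterlim_locally theta (theta s))). intros eps.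
  assert (Hm : 0 < Rmin eps (Rmin (theta s) ((PI - theta s) / 2))).
  { apply Rmin_pos; [apply cond_pos|apply Rmin_pos; lra]. }
  assert (H1 := Rmin_l eps (Rmin (theta s) ((PI - theta s) / 2))).
  assert (H2 := Rmin_r eps (Rmin (theta s) ((PI - theta s) / 2))).
  assert (H3 := Rmin_l (theta s) ((PI - theta s) / 2)).
  assert (H4 := Rmin_r (theta s) ((PI - theta s) / 2)).
  set (h := Rmin eps (Rmin (theta s) ((PI - theta s) / 2))) in *.
  assert (Hl : phi (theta s - h) < s) by (rewrite <- E at 2; apply prufer_incr; lra).
  assert (Hu : s < phi (theta s + h)) by (rewrite <- E at 1; apply prufer_incr; lra).
  assert (Hd : 0 < Rmin (Rmin (s - phi (theta s - h)) (phi (theta s + h) - s))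
                        (Rmin s (send - s))) by (repeat apply Rmin_pos; lra).
  exists (mkposreal _ Hd). intros v Hv.
  change (Rabs (v - s) < Rmin (Rmin (s - phi (theta s - h)) (phi (theta s + h) - s))
                        (Rmin s (send - s))) in Hv.
  apply Rmin_Rgt_l in Hv as [Hv1 Hv2].
  apply Rmin_Rgt_l in Hv1 as [Hva Hvb]. apply Rmin_Rgt_l in Hv2 as [Hvc Hvd].
  apply Rabs_def2 in Hva. apply Rabs_def2 in Hvb. apply Rabs_def2 in Hvc. apply Rabs_def2 in Hvd.
  change (Rabs (theta v - theta s) < eps).
  destruct (theta_bounds_near v (theta s - h) (theta s + h)); try lra.
  apply Rabs_def1; lra.
Qed.

Lemma is_derive_theta s : 0 < s < send ->
  is_derive theta s (/ (w - sin s * cos s / damping_inv beta (theta s))).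
Proof.
  intros Hs. destruct (Htheta s Hs) as [Hr E].
  assert (D := prufer_dphi Hsys _ Hr).
  assert (P := prufer_dphi_pos Hsys _ Hr).
  rewrite E in D, P. rewrite <- E at 1.
  apply (is_derive_inverse phi theta (theta s) _ (Rmin s (send - s))).
  - exact D.
  - lra.
  - apply Rmin_pos; lra.
  - rewrite E. intros v Hv. apply Rmin_Rgt_l in Hv as [Hv1 Hv2].
    apply Rabs_def2 in Hv1. apply Rabs_def2 in Hv2. apply Htheta. lra.
  - rewrite E. reflexivity.
  - rewrite E. apply continuous_theta, Hs.
Qed.

(** This is p_m. The derivative of [ln (r2 (theta s))] involves [theta] only through it, so the
    comparison of amplitudes reduces to that of stiffnesses. *)
Definition stiffness (s : R) : R := w * damping_inv beta (theta s).

Lemma stiffness_pos s : 0 < s < send -> 0 < stiffness s.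
Proof.
  intros Hs. destruct (Htheta s Hs) as [Hr _].
  apply Rmult_lt_0_compat; [exact (prufer_freq Hsys)|].
  apply damping_inv_pos; assumption.
Qed.

(** The positive slope of the phase, multiplied by [damping_inv]; it is the denominator in all later
    derivative formulas. *)
Lemma stiffness_gap s : 0 < s < send -> 0 < stiffness s - sin s * cos s.
Proof.
  intros Hs. destruct (Htheta s Hs) as [Hr E].
  assert (P := prufer_dphi_pos Hsys _ Hr). rewrite E in P.
  assert (Hg := damping_inv_pos beta _ beta_ge Hr). unfold stiffness.
  replace (w * damping_inv beta (theta s) - sin s * cos s)
    with ((w - sin s * cos s / damping_inv beta (theta s)) * damping_inv beta (theta s))
    by (field; lra).
  apply Rmult_lt_0_compat; assumption.
Qed.

Lemma is_derive_stiffness s : 0 < s < send ->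
  is_derive stiffness s
    (damping_inv' beta (theta s) * (stiffness s / (stiffness s - sin s * cos s))).
Proof.
  intros Hs. destruct (Htheta s Hs) as [Hr E].
  assert (Hgap := stiffness_gap s Hs). unfold stiffness in Hgap.
  assert (P := prufer_dphi_pos Hsys _ Hr). rewrite E in P.
  assert (Hg := damping_inv_pos beta _ beta_ge Hr).
  evar_last.
  { apply (is_derive_scal (fun s => damping_inv beta (theta s)) s w).
    apply (is_derive_comp (damping_inv beta) theta s).
    - apply is_derive_damping_inv, beta_ge.
    - apply is_derive_theta, Hs. }
  unfold stiffness, scal. simpl. unfold mult. simpl.
  field. repeat split; lra.
Qed.

Lemma stiffness_limit_0 eps : 0 < eps ->
  exists d, 0 < d /\ forall s, 0 < s < d -> s < send -> stiffness s < eps.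
Proof.
  intros Heps. assert (Hw := prufer_freq Hsys).
  assert (Hc : continuous (damping_inv beta) 0)
    by apply (is_derive_continuous _ _ _ (is_derive_damping_inv beta 0 beta_ge)).
  destruct (continuous_near _ _ (eps / w) Hc) as [d [Hd Hnear]].
  { apply Rdiv_lt_0_compat; assumption. }
  destruct (theta_limit_0 d Hd) as [d' [Hd' Hth]].
  exists d'. split; [exact Hd'|]. intros s Hs Hse.
  destruct (Htheta s ltac:(lra)) as [Hr _].
  assert (Hts := Hth s Hs Hse).
  assert (Hn : Rabs (theta s - 0) < d) by (rewrite Rminus_0_r, Rabs_pos_eq; lra).
  apply Hnear, Rabs_def2 in Hn.
  assert (E0 : damping_inv beta 0 = 0) by (unfold damping_inv; rewrite sin_0; apply Rmult_0_l).
  rewrite E0 in Hn. unfold stiffness.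
  apply Rlt_le_trans with (w * (eps / w)); [apply Rmult_lt_compat_l; lra|].
  right. field. lra.
Qed.

Lemma is_derive_ln_r2_theta s : 0 < s < send ->
  is_derive (fun s => ln (r2 (theta s))) s
    (- (2 * sin s ^ 2 / (stiffness s - sin s * cos s))).
Proof.
  intros Hs. destruct (Htheta s Hs) as [Hr E].
  assert (Hgap := stiffness_gap s Hs). unfold stiffness in Hgap.
  assert (P := prufer_dphi_pos Hsys _ Hr). rewrite E in P.
  assert (Hg := damping_inv_pos beta _ beta_ge Hr).
  assert (Hr2 := prufer_r2_pos Hsys (theta s) ltac:(lra)).
  assert (D := prufer_dr2 Hsys _ Hr). rewrite E in D.
  evar_last.
  { apply (is_derive_comp (fun t => ln (r2 t)) theta s).
    - apply (is_derive_comp ln r2 (theta s)); [|exact D].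
      apply is_derive_Reals, derivable_pt_lim_ln, Hr2.
    - apply is_derive_theta, Hs. }
  unfold stiffness, scal. simpl. unfold mult. simpl.
  field. repeat split; lra.
Qed.

Lemma ln_r2_theta_limit_0 eps : 0 < eps ->
  exists d, 0 < d /\ forall s, 0 < s < d -> s < send -> Rabs (ln (r2 (theta s))) < eps.
Proof.
  intros Heps. assert (E0 := prufer_r20 Hsys).
  assert (Hc : continuous (fun t => ln (r2 t)) 0).
  { apply (continuous_comp r2 ln); [exact (prufer_r2_cont Hsys)|].
    rewrite E0. apply (is_derive_continuous ln 1 (/ 1)).
    apply is_derive_Reals, derivable_pt_lim_ln. lra. }
  destruct (continuous_near _ _ eps Hc Heps) as [d [Hd Hnear]].
  destruct (theta_limit_0 d Hd) as [d' [Hd' Hth]].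
  exists d'. split; [exact Hd'|]. intros s Hs Hse.
  destruct (Htheta s ltac:(lra)) as [Hr _].
  assert (Hts := Hth s Hs Hse).
  assert (Hn : Rabs (theta s - 0) < d) by (rewrite Rminus_0_r, Rabs_pos_eq; lra).
  apply Hnear in Hn. rewrite E0, ln_1, Rminus_0_r in Hn. exact Hn.
Qed.

End Inverse.

End OnePhase.

(* At [beta = - 1 / 3] the strict inequality survives only through the
   second-order term in [1 - x']; this is where the bound on [beta] is sharp. *)
Lemma damping_ratio_lt (beta x x' : R) :
  - (1 / 3) <= beta -> -1 <= x' -> x' < x -> x <= 1 -> 0 <= (1 + beta) * x' - beta ->
  ((1 + beta) * x' - beta) / (1 + beta - beta * x') ^ 2 <
  ((1 + beta) * x - beta) / (1 + beta - beta * x) ^ 2.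
Proof.
  intros Hb H1 Hlt H2 Hpos.
  assert (HB : 0 < 1 + beta - beta * x) by nra.
  assert (HB' : 0 < 1 + beta - beta * x') by nra.
  set (B := 1 + beta - beta * x) in *. set (B' := 1 + beta - beta * x') in *.
  set (A' := (1 + beta) * x' - beta) in *.
  (* What remains of the cross-multiplied difference of the two fractions after the factor [x - x']
     is split off. *)
  assert (Hkey : 0 < (1 + beta) * B' ^ 2 + beta * A' * (B' + B)).
  { destruct (Rle_lt_dec 0 beta) as [Hb0|Hb0].
    - assert (0 <= beta * A' * (B' + B)) by (apply Rmult_le_pos; [apply Rmult_le_pos|]; lra).
      assert (0 < (1 + beta) * B' ^ 2) by (apply Rmult_lt_0_compat; nra). lra.
    (* For negative [beta] the product [beta * A'] is nonpositive, so replacing [B] by its bound 1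
       only lowers the expression, and [x] drops out. *)
    - assert (HB1 : B <= 1) by (unfold B; nra).
      apply Rlt_le_trans with ((1 + beta) * B' ^ 2 + beta * A' * (B' + 1)).
      + replace ((1 + beta) * B' ^ 2 + beta * A' * (B' + 1))
          with (1 + 3 * beta + beta ^ 2 * (1 - x')) by (unfold A', B'; ring).
        assert (0 < beta ^ 2 * (1 - x')) by (apply Rmult_lt_0_compat; nra). lra.
      + assert (0 <= - beta * A' * (1 - B)) by (apply Rmult_le_pos; [apply Rmult_le_pos|]; lra).
        nra. }
  assert (HD : ((1 + beta) * x - beta) / B ^ 2 - A' / B' ^ 2
    = (x - x') * ((1 + beta) * B' ^ 2 + beta * A' * (B' + B)) / (B ^ 2 * B' ^ 2)).
  { unfold A'. unfold B, B' in *. field. split; lra. }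
  assert (0 < ((1 + beta) * x - beta) / B ^ 2 - A' / B' ^ 2); [|lra].
  rewrite HD. apply Rdiv_lt_0_compat; [apply Rmult_lt_0_compat; lra|].
  apply Rmult_lt_0_compat; nra.
Qed.

Lemma damping_inv'_decr (beta t t' : R) :
  - (1 / 3) <= beta -> 0 <= t -> t < t' -> t' <= PI -> 0 <= damping_inv' beta t' ->
  damping_inv' beta t' < damping_inv' beta t.
Proof.
  intros Hb Ht Hlt Ht' Hpos.
  assert (Hc : cos t' < cos t) by (apply cos_decreasing_1; lra).
  assert (B := COS_bound t). assert (B' := COS_bound t').
  apply damping_ratio_lt; try lra.
  apply Rnot_lt_le. intros Hneg.
  assert (H := damping_den_pos beta t' Hb).
  assert (damping_inv' beta t' < 0); [|lra].
  unfold damping_inv'. apply Rmult_neg_pos; [exact Hneg|].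
  apply Rinv_0_lt_compat. nra.
Qed.

(** * Ordering of phases, stiffnesses and amplitudes for two frequencies *)

Section TwoPhases.

Variables (beta w1 w2 : R) (phi1 phi2 r1 r2 : R -> R).
Hypothesis beta_ge : - (1 / 3) <= beta.
Hypothesis Hsys1 : prufer_system beta w1 phi1 r1.
Hypothesis Hsys2 : prufer_system beta w2 phi2 r2.
Hypothesis Hw : w1 < w2.

Lemma phase_lt t : 0 < t < PI -> phi1 t < phi2 t.
Proof.
  intros Ht. assert (0 < phi2 t - phi1 t); [|lra].
  apply (upward_zeros_stay_pos (fun t => phi2 t - phi1 t)
           (fun t => Derive phi2 t - Derive phi1 t) 0 t).
  - intros u Hu. apply (is_derive_minus phi2 phi1).
    + apply (prufer_Derive_pos _ _ _ _ Hsys2). lra.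
    + apply (prufer_Derive_pos _ _ _ _ Hsys1). lra.
  - intros u [[Hu|Hu] Hut] E.
    + assert (Hu' : 0 < u < PI) by lra.
      rewrite (is_derive_unique _ _ _ (prufer_dphi Hsys1 u Hu')),
        (is_derive_unique _ _ _ (prufer_dphi Hsys2 u Hu')).
      replace (phi2 u) with (phi1 u) by lra. lra.
    + subst u. rewrite (is_derive_unique _ _ _ (prufer_dphi0 Hsys1)),
        (is_derive_unique _ _ _ (prufer_dphi0 Hsys2)). lra.
  - rewrite (prufer_phi0 Hsys1), (prufer_phi0 Hsys2). lra.
  - lra.
Qed.

(* Just below [s] the damping term pushes phases apart, so two distinct phases
   cannot both converge to [s]. *)
Lemma next_phase_reaches s : cos s = 0 -> phase_tends phi1 s ->
  exists t, 0 <= t < PI /\ s <= phi2 t.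
Proof.
  intros Hcos [Hlt1 Hsup].
  destruct (classic (exists t, 0 <= t < PI /\ s <= phi2 t)) as [H|H];
    [exact H|exfalso].
  assert (Hlt2 : forall t, 0 <= t < PI -> phi2 t < s).
  { intros t Ht. apply Rnot_le_lt. intros Hle. apply H. exists t. split; assumption. }
  assert (Hpi := PI_RGT_0).
  (* For [x] within [PI / 4] below [s] the angle [2 * (s - x)] lies in [[0, PI / 2]], where the sine
     increases. Hence sin x cos x decreases in [x] there, and the larger phase has the smaller
     damping term. *)
  destruct (Hsup (PI / 4)) as [t0 [Ht0 Hphi0]]; [lra|].
  set (t1 := (t0 + PI) / 2).
  assert (Ht1 : 0 < t1 < PI) by (unfold t1; lra).
  assert (Hphi1 : s - PI / 4 < phi1 t1).
  { assert (phi1 t0 < phi1 t1); [|lra].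
    apply (prufer_incr _ _ _ _ Hsys1); unfold t1; lra. }
  assert (Hsin : forall x, sin x * cos x = sin (2 * (s - x)) / 2).
  { intros x. replace (2 * (s - x)) with (2 * s - 2 * x) by ring.
    rewrite sin_minus, (sin_2a s), (cos_2a_cos s), (sin_2a x), Hcos. field. }
  assert (Hmono : forall t, t1 <= t < PI -> phi2 t1 - phi1 t1 <= phi2 t - phi1 t).
  { intros t Ht.
    apply (nonneg_derive_le (fun t => phi2 t - phi1 t)
      (fun t => (w2 - sin (phi2 t) * cos (phi2 t) / damping_inv beta t)
                - (w1 - sin (phi1 t) * cos (phi1 t) / damping_inv beta t)) 0 PI); try lra.
    - intros u Hu. apply (is_derive_minus phi2 phi1).
      + apply (prufer_dphi Hsys2 u Hu).
      + apply (prufer_dphi Hsys1 u Hu).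
    - intros u Hu. assert (Hlt := phase_lt u ltac:(lra)).
      assert (Hs2 := Hlt2 u ltac:(lra)).
      assert (phi1 t1 < phi1 u) by (apply (prufer_incr _ _ _ _ Hsys1); lra).
      assert (Hle : sin (phi2 u) * cos (phi2 u) <= sin (phi1 u) * cos (phi1 u)).
      { rewrite !Hsin. assert (sin (2 * (s - phi2 u)) <= sin (2 * (s - phi1 u))); [|lra].
        apply sin_incr_1; lra. }
      assert (Hg := damping_inv_pos beta u beta_ge ltac:(lra)).
      apply Rinv_0_lt_compat in Hg. unfold Rdiv. nra. }
  assert (Heta := phase_lt t1 Ht1).
  (* The gap at [t1] never shrinks afterwards, so once [phi1] is closer to [s] than this gap, [phi2]
     exceeds [s]. *)
  destruct (Hsup (phi2 t1 - phi1 t1)) as [t [Ht Hphi]]; [lra|].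
  destruct (Rle_lt_dec t1 t) as [Hle|Hgt].
  - specialize (Hmono t ltac:(lra)). specialize (Hlt2 t Ht). lra.
  - assert (phi1 t < phi1 t1) by (apply (prufer_incr _ _ _ _ Hsys1); lra).
    specialize (Hlt2 t1 ltac:(lra)). lra.
Qed.

Variables (send : R) (th1 th2 : R -> R).
Hypothesis Hsend : 0 < send.
Hypothesis Hth1 : forall s, 0 < s < send -> 0 < th1 s < PI /\ phi1 (th1 s) = s.
Hypothesis Hth2 : forall s, 0 < s < send -> 0 < th2 s < PI /\ phi2 (th2 s) = s.

Lemma theta_lt s : 0 < s < send -> th2 s < th1 s.
Proof.
  intros Hs. destruct (Hth1 s Hs) as [H1 E1]. destruct (Hth2 s Hs) as [H2 E2].
  apply (prufer_lt_inv _ _ _ _ Hsys2); try lra.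
  rewrite E2. rewrite <- E1 at 1. apply phase_lt, H1.
Qed.

Local Notation p1 := (stiffness beta w1 th1).
Local Notation p2 := (stiffness beta w2 th2).

(** From [p2 s <= p1 s] and [w1 < w2], [damping_inv] is smaller at [th2 s] than at [th1 s] although
    [th2 s < th1 s], which forces a positive [damping_inv'] at [th2 s]. The first factors are then
    ordered by [damping_inv'_decr], or by sign. The second factors agree at a crossing and are
    ordered when sin s cos s is nonnegative, since p / (p - c) is nonincreasing in p for c >= 0. *)
Lemma stiffness_order_step s : 0 < s < send -> p2 s <= p1 s ->
  p2 s = p1 s \/ 0 <= sin s * cos s ->
  damping_inv' beta (th1 s) * (p1 s / (p1 s - sin s * cos s)) <
  damping_inv' beta (th2 s) * (p2 s / (p2 s - sin s * cos s)).
Proof.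
  intros Hs Hle Hcase.
  destruct (Hth1 s Hs) as [H1 _]. destruct (Hth2 s Hs) as [H2 _].
  assert (Hlt := theta_lt s Hs).
  assert (G1 := stiffness_gap _ _ _ _ beta_ge Hsys1 _ _ Hth1 s Hs).
  assert (G2 := stiffness_gap _ _ _ _ beta_ge Hsys2 _ _ Hth2 s Hs).
  assert (P1 := stiffness_pos _ _ _ _ beta_ge Hsys1 _ _ Hth1 s Hs).
  assert (P2 := stiffness_pos _ _ _ _ beta_ge Hsys2 _ _ Hth2 s Hs).
  assert (Q1 := Rdiv_lt_0_compat _ _ P1 G1). assert (Q2 := Rdiv_lt_0_compat _ _ P2 G2).
  assert (Hw1 := prufer_freq Hsys1).
  assert (Hg1 := damping_inv_pos beta _ beta_ge H1).
  assert (Hg2 := damping_inv_pos beta _ beta_ge H2).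
  assert (Hg : damping_inv beta (th2 s) < damping_inv beta (th1 s)).
  { unfold stiffness in Hle. nra. }
  assert (Hpos2 : 0 < damping_inv' beta (th2 s)).
  { destruct (Rlt_le_dec 0 ((1 + beta) * cos (th2 s) - beta)) as [Hp|Hn];
      [apply damping_inv'_sign; assumption|exfalso].
    assert (- damping_inv beta (th2 s) <= - damping_inv beta (th1 s)); [|lra].
    apply (nonneg_derive_le (fun u => - damping_inv beta u)
             (fun u => - damping_inv' beta u) 0 PI); try lra.
    - intros u Hu. apply (is_derive_opp (damping_inv beta)), is_derive_damping_inv, beta_ge.
    - intros u Hu. assert (damping_inv' beta u <= 0); [|lra].
      apply damping_inv'_sign; [exact beta_ge|].
      assert (cos u < cos (th2 s)) by (apply cos_decreasing_1; lra).
      assert (0 < 1 + beta) by lra. nra. }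
  destruct (Rlt_le_dec 0 (damping_inv' beta (th1 s))) as [Hpos1|Hneg1]; [|nra].
  assert (Hd := damping_inv'_decr beta (th2 s) (th1 s) beta_ge ltac:(lra) Hlt ltac:(lra)
                  ltac:(lra)).
  assert (HQ : p1 s / (p1 s - sin s * cos s) <= p2 s / (p2 s - sin s * cos s)).
  { set (c := sin s * cos s) in *. destruct Hcase as [E|Hc]; [rewrite E; lra|].
    assert (HD : p2 s / (p2 s - c) - p1 s / (p1 s - c)
      = c * (p1 s - p2 s) / ((p1 s - c) * (p2 s - c))) by (field; lra).
    assert (0 <= p2 s / (p2 s - c) - p1 s / (p1 s - c)); [|lra].
    rewrite HD. apply Rdiv_le_0_compat; [apply Rmult_le_pos; lra|].
    apply Rmult_lt_0_compat; assumption. }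
  nra.
Qed.

Lemma stiffness_lt s : 0 < s < send -> p1 s < p2 s.
Proof.
  intros Hs. assert (0 < p2 s - p1 s); [|lra].
  assert (Hpi := PI_RGT_0).
  (* Up to [PI / 2] sine and cosine are both nonnegative, so the second alternative of
     [stiffness_order_step] applies near 0. *)
  assert (Hm : 0 < Rmin (send / 2) (PI / 2)) by (apply Rmin_pos; lra).
  assert (Hm1 := Rmin_l (send / 2) (PI / 2)). assert (Hm2 := Rmin_r (send / 2) (PI / 2)).
  apply (upward_zeros_pos_from_limit_zero (fun s => p2 s - p1 s)
    (fun s => damping_inv' beta (th2 s) * (p2 s / (p2 s - sin s * cos s))
              - damping_inv' beta (th1 s) * (p1 s / (p1 s - sin s * cos s)))
    send (Rmin (send / 2) (PI / 2))); try lra.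
  - intros u Hu. apply (is_derive_minus p2 p1).
    + apply (is_derive_stiffness _ _ _ _ beta_ge Hsys2 _ _ Hth2 u Hu).
    + apply (is_derive_stiffness _ _ _ _ beta_ge Hsys1 _ _ Hth1 u Hu).
  - intros u Hu E.
    assert (H := stiffness_order_step u Hu ltac:(lra) ltac:(left; lra)). lra.
  - intros u Hu Hle.
    assert (0 <= sin u) by (apply sin_ge_0; lra).
    assert (0 <= cos u) by (apply cos_ge_0; lra).
    assert (H1 : 0 <= sin u * cos u) by (apply Rmult_le_pos; assumption).
    assert (H2 := stiffness_order_step u ltac:(lra) ltac:(lra) (or_intror H1)). lra.
  - intros eps Heps.
    destruct (stiffness_limit_0 _ _ _ _ beta_ge Hsys1 _ _ Hth1 eps Heps) as [d1 [Hd1 L1]].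
    destruct (stiffness_limit_0 _ _ _ _ beta_ge Hsys2 _ _ Hth2 eps Heps) as [d2 [Hd2 L2]].
    assert (Hd := Rmin_pos _ _ (Rmin_pos _ _ Hd1 Hd2) Hsend).
    exists (Rmin (Rmin d1 d2) send). split; [exact Hd|]. intros u [Hu0 Hu].
    apply Rmin_Rgt_l in Hu as [Hu Hus]. apply Rmin_Rgt_l in Hu as [Hu1 Hu2].
    specialize (L1 u ltac:(lra) Hus). specialize (L2 u ltac:(lra) Hus).
    assert (P1 := stiffness_pos _ _ _ _ beta_ge Hsys1 _ _ Hth1 u ltac:(lra)).
    assert (P2 := stiffness_pos _ _ _ _ beta_ge Hsys2 _ _ Hth2 u ltac:(lra)).
    apply Rabs_def1; lra.
Qed.

Lemma amplitude_sqr_lt s : 0 < s < send -> r1 (th1 s) < r2 (th2 s).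
Proof.
  intros Hs. destruct (Hth1 s Hs) as [H1 _]. destruct (Hth2 s Hs) as [H2 _].
  assert (R1 := prufer_r2_pos Hsys1 (th1 s) ltac:(lra)).
  assert (R2 := prufer_r2_pos Hsys2 (th2 s) ltac:(lra)).
  apply ln_lt_inv; try assumption.
  set (e u := ln (r2 (th2 u)) - ln (r1 (th1 u))).
  set (de u := - (2 * sin u ^ 2 / (p2 u - sin u * cos u))
               - - (2 * sin u ^ 2 / (p1 u - sin u * cos u))).
  assert (De : forall u, 0 < u < send -> is_derive e u (de u)).
  { intros u Hu. apply (is_derive_minus (fun u => ln (r2 (th2 u))) (fun u => ln (r1 (th1 u)))).
    - apply (is_derive_ln_r2_theta _ _ _ _ beta_ge Hsys2 _ _ Hth2 u Hu).
    - apply (is_derive_ln_r2_theta _ _ _ _ beta_ge Hsys1 _ _ Hth1 u Hu). }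
  assert (Hde : forall u, 0 < u < send -> exists k, 0 < k /\ de u = sin u ^ 2 * k).
  { intros u Hu.
    assert (G1 := stiffness_gap _ _ _ _ beta_ge Hsys1 _ _ Hth1 u Hu).
    assert (G2 := stiffness_gap _ _ _ _ beta_ge Hsys2 _ _ Hth2 u Hu).
    assert (Hp := stiffness_lt u Hu).
    exists (2 * (p2 u - p1 u) / ((p1 u - sin u * cos u) * (p2 u - sin u * cos u))). split.
    - apply Rdiv_lt_0_compat; [lra|]. apply Rmult_lt_0_compat; assumption.
    - unfold de. field. lra. }
  assert (Hnn : forall u, 0 < u < send -> 0 <= de u).
  { intros u Hu. destruct (Hde u Hu) as [k [Hk ->]].
    apply Rmult_le_pos; [nra|lra]. }
  assert (0 < e s); [|unfold e in *; lra].
  assert (Hpi := PI_RGT_0).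
  assert (Hm : 0 < Rmin s PI) by (apply Rmin_pos; lra).
  assert (Hm1 := Rmin_l s PI). assert (Hm2 := Rmin_r s PI).
  (* The derivative of [e] vanishes where the sine does. The strict gain is therefore taken between
     [x / 4] and [x / 2], inside [(0, PI)]; the limit 0 at the origin gives [0 <= e (x / 4)]. *)
  set (x := Rmin s PI) in *.
  assert (Hlow : 0 <= e (x / 4)).
  { apply Rnot_lt_le. intros Hneg.
    destruct (ln_r2_theta_limit_0 _ _ _ _ Hsys1 _ _ Hth1 (- e (x / 4) / 2)) as [d1 [Hd1 L1]];
      [lra|].
    destruct (ln_r2_theta_limit_0 _ _ _ _ Hsys2 _ _ Hth2 (- e (x / 4) / 2)) as [d2 [Hd2 L2]];
      [lra|].
    assert (Hd : 0 < Rmin (Rmin (d1 / 2) (d2 / 2)) (x / 4)) by (repeat apply Rmin_pos; lra).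
    assert (A1 := Rmin_l (Rmin (d1 / 2) (d2 / 2)) (x / 4)).
    assert (A2 := Rmin_r (Rmin (d1 / 2) (d2 / 2)) (x / 4)).
    assert (A3 := Rmin_l (d1 / 2) (d2 / 2)). assert (A4 := Rmin_r (d1 / 2) (d2 / 2)).
    set (u := Rmin (Rmin (d1 / 2) (d2 / 2)) (x / 4)) in *.
    assert (e u <= e (x / 4)).
    { apply (nonneg_derive_le e de 0 send); try lra; [exact De|].
      intros v Hv. apply Hnn. lra. }
    specialize (L1 u ltac:(lra) ltac:(lra)). specialize (L2 u ltac:(lra) ltac:(lra)).
    apply Rabs_def2 in L1. apply Rabs_def2 in L2. unfold e in *. lra. }
  assert (Hmid : e (x / 4) < e (x / 2)).
  { apply (pos_derive_lt e de 0 send); try lra; [exact De|].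
    intros v Hv. destruct (Hde v ltac:(lra)) as [k [Hk ->]].
    assert (0 < sin v) by (apply sin_gt_0; lra).
    apply Rmult_lt_0_compat; [nra|exact Hk]. }
  assert (Hhigh : e (x / 2) <= e s).
  { apply (nonneg_derive_le e de 0 send); try lra; [exact De|].
    intros v Hv. apply Hnn. lra. }
  lra.
Qed.

End TwoPhases.

(** * Jacobi polynomials *)

(** Degree at most [n] in Horner form, so that splitting off a root is an induction on [n]. *)
Fixpoint polynomial_le (n : nat) (f : R -> R) : Prop :=
  match n with
  | O => exists c, forall u, f u = c
  | S k => exists c g, polynomial_le k g /\ forall u, f u = c + u * g u
  end.

(** Synthetic division: if g(u) = g(r) + (u - r) h(u), then u g(u) - r g(r) = (u - r) (g(r) + u
    h(u)). *)
Lemma polynomial_le_factor (n : nat) (f : R -> R) (r : R) :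
  polynomial_le (S n) f ->
  exists g, polynomial_le n g /\ forall u, f u = f r + (u - r) * g u.
Proof.
  revert f. induction n as [|n IH]; intros f [c [g [Hg Hf]]].
  - exists g. split; [exact Hg|]. destruct Hg as [d Hd]. intros u.
    rewrite !Hf, !Hd. ring.
  - destruct (IH g Hg) as [h [Hh Hgh]].
    exists (fun u => g r + u * h u). split.
    + exists (g r), h. split; [exact Hh|reflexivity].
    + intros u. rewrite !Hf, (Hgh u). ring.
Qed.

Lemma polynomial_le_roots (n : nat) (f : R -> R) (x : nat -> R) :
  polynomial_le n f ->
  (forall i, (i <= n)%nat -> f (x i) = 0) ->
  (forall i j, (i < j <= n)%nat -> x i <> x j) ->
  forall u, f u = 0.
Proof.
  revert f. induction n as [|n IH]; intros f Hf Hroot Hdist u.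
  - destruct Hf as [c Hc]. rewrite Hc, <- (Hc (x 0%nat)). apply Hroot. lia.
  - destruct (polynomial_le_factor n f (x (S n)) Hf) as [g [Hg Hfg]].
    rewrite (Hroot (S n)) in Hfg by lia.
    assert (Hz : forall v, g v = 0).
    { apply (IH g Hg).
      - intros i Hi. assert (H := Hroot i ltac:(lia)). rewrite Hfg in H.
        assert (Hne := Hdist i (S n) ltac:(lia)).
        rewrite Rplus_0_l in H. apply Rmult_integral in H as [H|H]; [lra|exact H].
      - intros i j Hij. apply Hdist. lia. }
    rewrite Hfg, Hz. ring.
Qed.

Lemma polynomial_le_sum (n : nat) (c : nat -> R) :
  polynomial_le n (fun u => sum_f_R0 (fun k => c k * u ^ k) n).
Proof.
  revert c. induction n as [|n IH]; intros c.
  - exists (c 0%nat). intros u. simpl. ring.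
  - exists (c 0%nat), (fun u => sum_f_R0 (fun k => c (S k) * u ^ k) n).
    split; [apply IH|]. intros u. rewrite decomp_sum by lia. simpl pred.
    rewrite scal_sum. simpl pow. rewrite Rmult_1_r. f_equal.
    apply sum_eq. intros i _. ring.
Qed.

(** A general exponent sequence lets the lemma be iterated. Where [e k = 0], [pred] leaves the
    exponent at 0, but the factor [INR (e k)] removes the term. *)
Lemma is_derive_power_sum (a : nat -> R) (e : nat -> nat) (n : nat) (u : R) :
  is_derive (fun u => sum_f_R0 (fun k => a k * u ^ e k) n) u
    (sum_f_R0 (fun k => a k * INR (e k) * u ^ pred (e k)) n).
Proof.
  assert (H1 : forall k, is_derive (fun u => a k * u ^ e k) u
                           (a k * INR (e k) * u ^ pred (e k))).
  { intros k. evar_last.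
    - auto_derive; [exact I|reflexivity].
    - ring. }
  induction n as [|n IH]; simpl sum_f_R0; [apply H1|].
  apply (is_derive_plus (fun u => sum_f_R0 (fun k => a k * u ^ e k) n)); [exact IH|apply H1].
Qed.

Lemma pochhammer_fact (k j : nat) :
  pochhammer (INR k + 1) j = INR (fact (k + j)) / INR (fact k).
Proof.
  induction j as [|j IH].
  - rewrite Nat.add_0_r. simpl. field. apply INR_fact_neq_0.
  - simpl pochhammer. rewrite IH, Nat.add_succ_r.
    rewrite fact_simpl, mult_INR, S_INR, plus_INR. field. apply INR_fact_neq_0.
Qed.

(** For first parameter 0 the factor [pochhammer (INR k + 1) (n - k)] is n! / k!, which cancels the
    leading 1 / n!. *)
Definition jacobi_coef (n : nat) (b : R) (k : nat) : R :=
  INR (fact n) / (INR (fact k) ^ 2 * INR (fact (n - k))) * pochhammer (INR n + b + 1) k.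

Lemma jacobi_coef_0 (n : nat) (b : R) : jacobi_coef n b 0 = 1.
Proof.
  unfold jacobi_coef. rewrite Nat.sub_0_r. simpl. field. apply INR_fact_neq_0.
Qed.

(** The ratio of consecutive hypergeometric coefficients, multiplied out; it is the power series
    form of the Jacobi equation at x = 1. *)
Lemma jacobi_coef_succ (n : nat) (b : R) (k : nat) : (k < n)%nat ->
  INR (S k) ^ 2 * jacobi_coef n b (S k)
  = (INR n - INR k) * (INR n + INR k + b + 1) * jacobi_coef n b k.
Proof.
  intros Hk. unfold jacobi_coef.
  replace (n - k)%nat with (S (n - S k)) by lia.
  assert (E : INR (n - S k) = INR n - INR k - 1).
  { rewrite minus_INR, S_INR by lia. ring. }
  assert (Hkn : INR k < INR n) by (apply lt_INR; lia).
  assert (Hk0 := pos_INR k).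
  rewrite !fact_simpl, !mult_INR, !S_INR, E. simpl pochhammer.
  field. repeat split; try apply INR_fact_neq_0; lra.
Qed.

Lemma jacobi_sum (n : nat) (b x : R) :
  jacobi n 0 b x = sum_f_R0 (fun k => jacobi_coef n b k * ((x - 1) / 2) ^ k) n.
Proof.
  unfold jacobi. rewrite scal_sum. apply sum_eq. intros k Hk.
  replace (0 + INR k + 1) with (INR k + 1) by ring. rewrite pochhammer_fact.
  replace (k + (n - k))%nat with n by lia.
  unfold jacobi_coef, Binomial.C. rewrite Rplus_0_r.
  field. repeat split; apply INR_fact_neq_0.
Qed.

Lemma polynomial_le_jacobi (n : nat) (b : R) :
  polynomial_le n (fun u => jacobi n 0 b (1 + 2 * u)).
Proof.
  assert (H := polynomial_le_sum n (jacobi_coef n b)).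
  assert (E : forall u, jacobi n 0 b (1 + 2 * u)
              = sum_f_R0 (fun k => jacobi_coef n b k * u ^ k) n).
  { intros u. rewrite jacobi_sum. replace ((1 + 2 * u - 1) / 2) with u by field. reflexivity. }
  destruct n as [|n].
  - destruct H as [c Hc]. exists c. intros u. rewrite E. apply Hc.
  - destruct H as [c [g [Hg Hc]]]. exists c, g. split; [exact Hg|].
    intros u. rewrite E. apply Hc.
Qed.

Lemma jacobi_1 (n : nat) (b : R) : jacobi n 0 b 1 = 1.
Proof.
  rewrite jacobi_sum. replace ((1 - 1) / 2) with 0 by field.
  destruct n as [|n]; [simpl; rewrite jacobi_coef_0; ring|].
  rewrite decomp_sum by lia. rewrite jacobi_coef_0, sum_eq_R0; [simpl; ring|].
  intros k _. simpl. ring.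
Qed.

Definition jacobi' (n : nat) (b x : R) : R :=
  / 2 * sum_f_R0 (fun k => jacobi_coef n b k * INR k * ((x - 1) / 2) ^ pred k) n.
Definition jacobi'' (n : nat) (b x : R) : R :=
  / 4 * sum_f_R0 (fun k => jacobi_coef n b k * INR k * INR (pred k)
                           * ((x - 1) / 2) ^ pred (pred k)) n.

Lemma is_derive_power_sum_shift (a : nat -> R) (e : nat -> nat) (n : nat) (c x : R) :
  is_derive (fun x => c * sum_f_R0 (fun k => a k * ((x - 1) / 2) ^ e k) n) x
    (c / 2 * sum_f_R0 (fun k => a k * INR (e k) * ((x - 1) / 2) ^ pred (e k)) n).
Proof.
  evar_last.
  - apply (is_derive_scal (fun x => sum_f_R0 (fun k => a k * ((x - 1) / 2) ^ e k) n)).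
    apply (is_derive_comp (fun u => sum_f_R0 (fun k => a k * u ^ e k) n)
             (fun x => (x - 1) / 2) x
             (sum_f_R0 (fun k => a k * INR (e k) * ((x - 1) / 2) ^ pred (e k)) n) (/ 2)).
    + apply is_derive_power_sum.
    + auto_derive; [exact I|field].
  - unfold scal. simpl. unfold mult. simpl. field.
Qed.

Lemma is_derive_jacobi (n : nat) (b x : R) :
  is_derive (jacobi n 0 b) x (jacobi' n b x).
Proof.
  apply (is_derive_ext
    (fun x => 1 * sum_f_R0 (fun k => jacobi_coef n b k * ((x - 1) / 2) ^ k) n)).
  - intros t. rewrite jacobi_sum. apply Rmult_1_l.
  - unfold jacobi'. replace (/ 2) with (1 / 2) by field.
    apply (is_derive_power_sum_shift (jacobi_coef n b) (fun k => k)).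
Qed.

Lemma is_derive_jacobi' (n : nat) (b x : R) :
  is_derive (jacobi' n b) x (jacobi'' n b x).
Proof.
  unfold jacobi', jacobi''. replace (/ 4) with (/ 2 / 2) by field.
  apply (is_derive_power_sum_shift (fun k => jacobi_coef n b k * INR k) pred).
Qed.

Lemma ex_derive_jacobi'' (n : nat) (b x : R) : ex_derive (jacobi'' n b) x.
Proof.
  eexists. apply (is_derive_power_sum_shift
    (fun k => jacobi_coef n b k * INR k * INR (pred k)) (fun k => pred (pred k))).
Qed.

Lemma jacobi_ode (n : nat) (b x : R) :
  (1 - x ^ 2) * jacobi'' n b x + (b - (b + 2) * x) * jacobi' n b x
  + INR n * (INR n + b + 1) * jacobi n 0 b x = 0.
Proof.
  rewrite jacobi_sum. unfold jacobi', jacobi''.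
  set (u := (x - 1) / 2). replace x with (1 + 2 * u) by (unfold u; field).
  set (c := jacobi_coef n b).
  (* By [jacobi_coef_succ] the terms telescope. *)
  assert (H : forall j, (j <= n)%nat ->
    u * (1 + u) * sum_f_R0 (fun k => c k * INR k * INR (pred k) * u ^ pred (pred k)) j
    + (1 + (b + 2) * u) * sum_f_R0 (fun k => c k * INR k * u ^ pred k) j
    - INR n * (INR n + b + 1) * sum_f_R0 (fun k => c k * u ^ k) j
    = - ((INR n - INR j) * (INR n + INR j + b + 1) * c j * u ^ j)).
  { induction j as [|j IH]; intros Hj.
    - simpl. ring.
    - rewrite !tech5.
      assert (E := jacobi_coef_succ n b j ltac:(lia)). fold c in E.
      specialize (IH ltac:(lia)).
      set (s2 := sum_f_R0 (fun k => c k * INR k * INR (pred k) * u ^ pred (pred k)) j) in *.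
      set (s1 := sum_f_R0 (fun k => c k * INR k * u ^ pred k) j) in *.
      set (s0 := sum_f_R0 (fun k => c k * u ^ k) j) in *.
      simpl (pred (S j)).
      (* At [j = 0] the truncated [pred] gives [u * u ^ 0] instead of [u ^ 0]; the factor [INR j]
         makes both sides 0. *)
      assert (Ej : INR j * u * u ^ pred j = INR j * u ^ j).
      { destruct j as [|j]; simpl; ring. }
      rewrite <- E in IH.
      transitivity (u * (1 + u) * s2 + (1 + (b + 2) * u) * s1
                    - INR n * (INR n + b + 1) * s0
        + c (S j) * INR (S j) * (1 + u) * (INR j * u * u ^ pred j)
        + (1 + (b + 2) * u) * (c (S j) * INR (S j) * u ^ j)
        - INR n * (INR n + b + 1) * (c (S j) * (u * u ^ j))).
      + simpl (u ^ S j). ring.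
      + rewrite IH, Ej, S_INR. simpl (u ^ S j). ring. }
  (* The remainder of the partial sums carries the factor [INR n - INR j], which vanishes at
     [j = n]. *)
  specialize (H n (le_n n)). rewrite Rminus_diag in H.
  transitivity (- (u * (1 + u)
        * sum_f_R0 (fun k => c k * INR k * INR (pred k) * u ^ pred (pred k)) n
    + (1 + (b + 2) * u) * sum_f_R0 (fun k => c k * INR k * u ^ pred k) n
    - INR n * (INR n + b + 1) * sum_f_R0 (fun k => c k * u ^ k) n)).
  - field.
  - rewrite H. ring.
Qed.

Lemma is_derive_Rpower_base (a z : R) : 0 < z ->
  is_derive (fun z => Rpower z a) z (a / z * Rpower z a).
Proof.
  intros Hz. unfold Rpower. evar_last.
  - auto_derive; [exact Hz|reflexivity].
  - field. lra.
Qed.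

(** * The weighted Jacobi function and its equation in the angle *)

Section Radau.

Variables (beta : R) (m : nat).
Hypothesis beta_ge : - (1 / 3) <= beta.
Hypothesis m_pos : (1 <= m)%nat.

Let b := beta + 1.
Let n := (m - 1)%nat.
Let K := Rpower 2 (- beta - 1).

Definition Q' (x : R) : R :=
  K * Rpower (1 + x) b * (b / (1 + x) * jacobi n 0 b x + jacobi' n b x).
Definition Q'' (x : R) : R :=
  K * Rpower (1 + x) b *
  (b * (b - 1) / (1 + x) ^ 2 * jacobi n 0 b x + 2 * b / (1 + x) * jacobi' n b x
   + jacobi'' n b x).

Lemma Q_interior (x : R) : -1 < x -> Q beta m x = K * Rpower (1 + x) b * jacobi n 0 b x.
Proof.
  intros Hx. unfold Q, pos_power. destruct (Rle_dec (1 + x) 0); [lra|reflexivity].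
Qed.

Lemma is_derive_Q (x : R) : -1 < x -> is_derive (Q beta m) x (Q' x).
Proof.
  intros Hx.
  apply (is_derive_ext_loc (fun x => K * Rpower (1 + x) b * jacobi n 0 b x)).
  - assert (Hd : 0 < x + 1) by lra. exists (mkposreal _ Hd). intros v Hv.
    change (Rabs (v - x) < x + 1) in Hv. apply Rabs_def2 in Hv.
    symmetry. apply Q_interior. lra.
  - assert (D := is_derive_Rpower_base b (1 + x) ltac:(lra)). assert (DJ := is_derive_jacobi n b x).
    evar_last.
    + auto_derive; [repeat split; eexists; eassumption|reflexivity].
    + replace (Derive (fun _ => jacobi n 0 b _) x) with (jacobi' n b x)
        by (symmetry; apply is_derive_unique, DJ).
      replace (Derive (fun z => Rpower z b) (1 + x)) with (b / (1 + x) * Rpower (1 + x) b)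
        by (symmetry; apply is_derive_unique, D).
      unfold Q'. field. lra.
Qed.

Lemma is_derive_Q' (x : R) : -1 < x -> is_derive Q' x (Q'' x).
Proof.
  intros Hx. assert (D := is_derive_Rpower_base b (1 + x) ltac:(lra)).
  assert (DJ := is_derive_jacobi n b x). assert (DJ' := is_derive_jacobi' n b x).
  unfold Q'. evar_last.
  - auto_derive; [repeat split; try (eexists; eassumption); lra|reflexivity].
  - replace (Derive (fun _ => jacobi n 0 b _) x) with (jacobi' n b x)
      by (symmetry; apply is_derive_unique, DJ).
    replace (Derive (fun _ => jacobi' n b _) x) with (jacobi'' n b x)
      by (symmetry; apply is_derive_unique, DJ').
    replace (Derive (fun z => Rpower z b) (1 + x)) with (b / (1 + x) * Rpower (1 + x) b)
      by (symmetry; apply is_derive_unique, D).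
    unfold Q''. field. lra.
Qed.

Lemma continuous_Q'' (x : R) : -1 < x -> continuous Q'' x.
Proof.
  intros Hx. apply (ex_derive_continuous Q'' x). unfold Q''.
  assert (D := is_derive_Rpower_base b (1 + x) ltac:(lra)).
  assert (DJ := is_derive_jacobi n b x). assert (DJ' := is_derive_jacobi' n b x).
  assert (DJ'' := ex_derive_jacobi'' n b x).
  auto_derive. repeat split; try (eexists; eassumption); try exact DJ''; try nra.
Qed.

Lemma omega_sqr : omega beta m ^ 2 = INR m * (INR m + beta).
Proof.
  unfold omega. rewrite pow2_sqrt; [reflexivity|].
  assert (1 <= INR m) by (apply (le_INR 1 m m_pos)). nra.
Qed.

Lemma omega_pos : 0 < omega beta m.
Proof.
  apply sqrt_lt_R0. assert (1 <= INR m) by (apply (le_INR 1 m m_pos)). nra.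
Qed.

(* [Q] solves the Jacobi equation with parameters [(0, - (beta + 1))]. *)
Lemma Q_ode (x : R) : -1 < x ->
  (1 - x ^ 2) * Q'' x + (- b + (b - 2) * x) * Q' x + omega beta m ^ 2 * Q beta m x = 0.
Proof.
  intros Hx. rewrite Q_interior, omega_sqr by exact Hx. unfold Q', Q''.
  assert (H := jacobi_ode n b x).
  assert (Em : INR m = INR n + 1) by (unfold n; rewrite minus_INR by exact m_pos; simpl; ring).
  rewrite Em. replace beta with (b - 1) by (unfold b; ring).
  apply (Rmult_eq_compat_l (K * Rpower (1 + x) b)) in H. rewrite Rmult_0_r in H.
  (* The derivatives of the weight contribute [- b] times the polynomial, which turns (n + 1)(n + b)
     into n (n + b + 1). *)
  etransitivity; [|exact H]. field. lra.
Qed.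

Lemma Q_1 : Q beta m 1 = 1.
Proof.
  rewrite Q_interior, jacobi_1, Rmult_1_r by lra. unfold K, b.
  replace (1 + 1) with 2 by ring. rewrite <- Rpower_plus.
  replace (- beta - 1 + (beta + 1)) with 0 by ring. apply Rpower_O. lra.
Qed.

(** Chain-rule formulas, used as derivatives of Y only for [|t| < PI]; at [PI] the base of [Rpower]
    in [Q'] is 0. *)
Definition Y1 (t : R) : R := - sin t * Q' (cos t).
Definition Y2 (t : R) : R := sin t ^ 2 * Q'' (cos t) - cos t * Q' (cos t).

Lemma cos_gt_m1 (t : R) : - PI < t < PI -> -1 < cos t.
Proof.
  intros Ht. rewrite <- cos_PI. destruct (Rle_lt_dec 0 t).
  - apply cos_decreasing_1; lra.
  - rewrite <- (cos_neg t). apply cos_decreasing_1; lra.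
Qed.

Lemma Y_at_PI : Y beta m PI = 0.
Proof.
  unfold Y, Q, pos_power. rewrite cos_PI. destruct (Rle_dec (1 + -1) 0); [ring|lra].
Qed.

(** With h = t - PI, 1 + cos t = 2 sin^2 (h / 2), and |sin z| <= |z|. *)
Lemma one_plus_cos_le (t : R) : 0 <= 1 + cos t <= (t - PI) ^ 2.
Proof.
  assert (Hb := COS_bound t). split; [lra|].
  replace (cos t) with (- cos (t - PI)).
  2:{ rewrite cos_minus, cos_PI, sin_PI. ring. }
  set (h := t - PI).
  replace h with (2 * (h / 2)) at 1 by field. rewrite cos_2a_sin.
  assert (Hs : sin (h / 2) ^ 2 <= (h / 2) ^ 2).
  { assert (Hpos : forall z, 0 <= z -> sin z ^ 2 <= z ^ 2).
    { intros z Hz. assert (Hbz := SIN_bound z).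
      destruct (Rle_lt_dec z 1) as [H1|H1]; [|nra].
      assert (Hpi := PI2_1). assert (0 <= sin z) by (apply sin_ge_0; lra).
      destruct Hz as [Hz|Hz]; [|subst z; rewrite sin_0; lra].
      assert (sin z < z) by (apply sin_lt_x, Hz). nra. }
    destruct (Rle_lt_dec 0 (h / 2)) as [H|H]; [apply Hpos, H|].
    replace (sin (h / 2) ^ 2) with (sin (- (h / 2)) ^ 2) by (rewrite sin_neg; ring).
    replace ((h / 2) ^ 2) with ((- (h / 2)) ^ 2) by ring. apply Hpos. lra. }
  nra.
Qed.

(* (1 + cos t)^b = O(|t - PI| (1 + cos t)^(b - 1/2)), and b > 1/2. *)
Lemma is_derive_Y_PI : is_derive (Y beta m) PI 0.
Proof.
  assert (Hcont : continuous (fun t => K * jacobi n 0 b (cos t)) PI).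
  { apply (continuous_mult (fun _ => K)); [apply continuous_const|].
    apply (continuous_comp cos (jacobi n 0 b)); [apply continuous_cos|].
    apply (is_derive_continuous _ _ _ (is_derive_jacobi n b (cos PI))). }
  destruct (continuous_near _ _ 1 Hcont Rlt_0_1) as [d1 [Hd1 Hb]].
  set (k0 := Rabs (K * jacobi n 0 b (cos PI)) + 1).
  assert (Hk0 : 0 < k0) by (unfold k0; assert (H := Rabs_pos (K * jacobi n 0 b (cos PI))); lra).
  apply is_derive_Reals. intros eps Heps.
  (* Since 2 b = 1 + 2 a, the bound |h|^(2 b) on the weight has one factor |h| for the difference
     quotient to cancel; [d2] makes the rest |h|^(2 a) smaller than [eps / k0], with [k0] bounding
     the polynomial part near [PI]. *)
  set (a := b - / 2). assert (Ha : 0 < a) by (unfold a, b; lra).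
  set (d2 := Rpower (eps / k0) (/ (2 * a))).
  assert (Hd2 : 0 < d2) by apply exp_pos.
  assert (Hm : 0 < Rmin d1 d2) by (apply Rmin_pos; assumption).
  exists (mkposreal _ Hm). simpl. intros h Hh Hhd.
  apply Rmin_Rgt_l in Hhd as [Hhd1 Hhd2].
  rewrite Y_at_PI, !Rminus_0_r.
  rewrite Rabs_div by exact Hh. assert (Hah : 0 < Rabs h) by (apply Rabs_pos_lt, Hh).
  apply Rlt_div_l; [exact Hah|].
  assert (Hc := one_plus_cos_le (PI + h)). replace (PI + h - PI) with h in Hc by ring.
  unfold Y, Q, pos_power. destruct (Rle_dec (1 + cos (PI + h)) 0) as [Hz|Hz].
  { rewrite Rmult_0_r, Rmult_0_l, Rabs_R0. apply Rmult_lt_0_compat; lra. }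
  assert (Hv : 0 < 1 + cos (PI + h)) by lra.
  specialize (Hb (PI + h)). replace (PI + h - PI) with h in Hb by ring.
  specialize (Hb Hhd1). fold n b K.
  set (j := K * jacobi n 0 b (cos (PI + h))) in *. set (v := 1 + cos (PI + h)) in *.
  replace (K * Rpower v b * jacobi n 0 b (cos (PI + h))) with (Rpower v b * j)
    by (unfold j; ring).
  assert (Hj : Rabs j < k0).
  { unfold k0. assert (H := Rabs_triang_inv j (K * jacobi n 0 b (cos PI))). lra. }
  rewrite Rabs_mult, (Rabs_pos_eq (Rpower v b)) by (left; apply exp_pos).
  assert (Hsq : v <= Rabs h ^ 2) by (rewrite pow2_abs; apply Hc).
  assert (Hvb : Rpower v b <= Rabs h * Rpower (Rabs h) (2 * a)).
  { rewrite <- (Rpower_1 (Rabs h)) at 1 by exact Hah. rewrite <- Rpower_plus.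
    replace (1 + 2 * a) with (INR 2 * b) by (unfold a; simpl; field).
    rewrite <- Rpower_mult, Rpower_pow by exact Hah.
    apply Rle_Rpower_l; [unfold b; lra|split; assumption]. }
  assert (Hpa : Rpower (Rabs h) (2 * a) < eps / k0).
  { replace (eps / k0) with (Rpower d2 (2 * a)).
    - apply Rlt_Rpower_l; [lra|split; assumption].
    - unfold d2. rewrite Rpower_mult. replace (/ (2 * a) * (2 * a)) with 1 by (field; lra).
      apply Rpower_1. apply Rdiv_lt_0_compat; assumption. }
  assert (H0 : 0 < Rpower (Rabs h) (2 * a)) by apply exp_pos.
  assert (H1 : 0 < Rpower v b) by apply exp_pos.
  apply Rle_lt_trans with (Rabs h * Rpower (Rabs h) (2 * a) * k0).
  - apply Rmult_le_compat; [lra|apply Rabs_pos|exact Hvb|lra].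
  - replace (eps * Rabs h) with (Rabs h * (eps / k0) * k0) by (field; lra).
    apply Rmult_lt_compat_r; [exact Hk0|]. apply Rmult_lt_compat_l; assumption.
Qed.

Lemma radau_equation_Y : radau_equation beta (omega beta m) (Y beta m) Y1 Y2.
Proof.
  assert (Hpi := PI_RGT_0).
  constructor.
  - exact omega_pos.
  - intros t Ht. assert (D := is_derive_Q (cos t) (cos_gt_m1 t Ht)).
    apply (is_derive_comp (Q beta m) cos t (Q' (cos t)) (- sin t)); [exact D|apply is_derive_cos].
  - intros t Ht. assert (D := is_derive_Q' (cos t) (cos_gt_m1 t Ht)).
    unfold Y1. evar_last.
    + auto_derive; [eexists; eassumption|reflexivity].
    + replace (Derive (fun x => Q' x) (cos t)) with (Q'' (cos t))
        by (symmetry; apply is_derive_unique, D).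
      unfold Y2. ring.
  - intros t Ht. assert (Hc := cos_gt_m1 t Ht).
    apply (continuous_minus (fun t => sin t ^ 2 * Q'' (cos t))).
    + apply (continuous_mult (fun t => sin t ^ 2)).
      * apply continuous_sqr, continuous_sin.
      * apply (continuous_comp cos Q''); [apply continuous_cos|apply continuous_Q'', Hc].
    + apply (continuous_mult cos); [apply continuous_cos|].
      apply (continuous_comp cos Q'); [apply continuous_cos|].
      apply (is_derive_continuous _ _ _ (is_derive_Q' (cos t) Hc)).
  - intros t. unfold Y. rewrite cos_neg. reflexivity.
  - intros t. unfold Y1. rewrite cos_neg, sin_neg. ring.
  - unfold Y. rewrite cos_0. exact Q_1.
  - unfold Y1. rewrite sin_0. ring.
  (* At x = 1 the leading coefficient vanishes and the equation reads - 2 Q'(1) + omega^2 = 0. *)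
  - unfold Y2. rewrite sin_0, cos_0. assert (H := Q_ode 1 ltac:(lra)).
    rewrite Q_1 in H. lra.
  - intros t Ht. assert (Hc := cos_gt_m1 t ltac:(lra)).
    assert (Hs : 0 < sin t) by (apply sin_gt_0; lra).
    assert (H := Q_ode (cos t) Hc). assert (Hg := damping_den_pos beta t beta_ge).
    assert (Hsc := sin2_cos2 t). unfold Rsqr in Hsc.
    unfold damping_inv. unfold damping_den in *. unfold Y1, Y2, Y.
    replace (sin t ^ 2) with (1 - cos t ^ 2) by (simpl; lra).
    replace (- sin t * Q' (cos t) / (sin t / (1 + beta - beta * cos t)))
      with (- Q' (cos t) * (1 + beta - beta * cos t)) by (field; lra).
    unfold b in H. lra.
  - split; [|exact Y_at_PI].
    apply (is_derive_continuous _ _ _ is_derive_Y_PI).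
Qed.

End Radau.

(** * The Radau functions *)

Lemma cos_phase_end (m : nat) : cos (phase_end m) = 0.
Proof.
  induction m as [|m IH].
  - replace (phase_end 0) with (- (PI / 2)) by (unfold phase_end; simpl; field).
    rewrite cos_neg. apply cos_PI2.
  - replace (phase_end (S m)) with (phase_end m + PI)
      by (unfold phase_end; rewrite S_INR; ring).
    rewrite neg_cos, IH. ring.
Qed.

Section RadauPhase.

Variable beta : R.
Hypothesis beta_ge : - (1 / 3) <= beta.

Definition radau_phase (m : nat) : R -> R :=
  phase_int (omega beta m) (Y beta m) (Y1 beta m) (Y2 beta m).

Definition radau_amplitude_sqr (m : nat) (t : R) : R :=
  Y beta m t ^ 2 + Y1 beta m t ^ 2 / omega beta m ^ 2.

Lemma prufer_system_radau (m : nat) : (1 <= m)%nat ->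
  prufer_system beta (omega beta m) (radau_phase m) (radau_amplitude_sqr m).
Proof.
  intros Hm. exact (prufer_system_phase_int _ _ _ _ _ beta_ge
                      (radau_equation_Y beta m beta_ge Hm)).
Qed.

Lemma dY_eq (m : nat) (t : R) : (1 <= m)%nat -> 0 <= t < PI -> dY beta m t = Y1 beta m t.
Proof.
  intros Hm Ht. apply is_derive_unique.
  apply (radau_dy (radau_equation_Y beta m beta_ge Hm)).
  assert (H := PI_RGT_0). lra.
Qed.

Lemma amplitude_eq (m : nat) (t : R) : (1 <= m)%nat -> 0 <= t < PI ->
  amplitude beta m t = sqrt (radau_amplitude_sqr m t).
Proof. intros Hm Ht. unfold amplitude. rewrite dY_eq by assumption. reflexivity. Qed.

Lemma amplitude_energy (m : nat) (t : R) : (1 <= m)%nat -> 0 <= t < PI ->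
  omega beta m * amplitude beta m t
  = sqrt (energy (omega beta m) (Y beta m) (Y1 beta m) t).
Proof.
  intros Hm Ht. rewrite amplitude_eq by assumption.
  assert (Hw := omega_pos beta m beta_ge Hm).
  rewrite <- (sqrt_pow2 (omega beta m)) at 1 by lra.
  rewrite <- sqrt_mult_alt by nra. f_equal.
  unfold energy, radau_amplitude_sqr. field. lra.
Qed.

(** [radau_phase m] meets the specification, so [epsilon] returns some phase, and uniqueness
    identifies the two on [[0, PI)]. *)
Lemma phase_eq (m : nat) (t : R) : (1 <= m)%nat -> 0 <= t < PI ->
  phase beta m t = radau_phase m t.
Proof.
  intros Hm Ht. assert (Hy := radau_equation_Y beta m beta_ge Hm).
  assert (Hw := omega_pos beta m beta_ge Hm). assert (Hpi := PI_RGT_0).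
  unfold phase. destruct (Rlt_dec t PI) as [_|H]; [|lra].
  assert (Hex : is_prufer_phase beta m (radau_phase m)).
  { split; [|split].
    - apply continuous_on_forall. intros u Hu.
      refine (is_derive_continuous _ _ _ (is_derive_phase_int _ _ _ _ _ beta_ge Hy u _)).
      split; [apply Rlt_le_trans with 0; [lra|apply Hu]|apply Hu].
    - exact (phase_int_0 (omega beta m) (Y beta m) (Y1 beta m) (Y2 beta m)).
    - intros u Hu. rewrite dY_eq by assumption.
      destruct (phase_int_lift _ _ _ _ _ beta_ge Hy u Hu) as [Ec Es].
      rewrite <- amplitude_energy in Ec, Es by assumption. split.
      + apply (Rmult_eq_reg_l (omega beta m)); [|lra]. rewrite Ec. unfold radau_phase. ring.
      + rewrite Es. unfold radau_phase. ring. }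
  destruct (epsilon_spec (inhabits (fun _ : R => 0)) (is_prufer_phase beta m)
              (ex_intro _ _ Hex)) as (Hc & H0 & Hphi).
  apply (phase_int_unique _ _ _ _ _ beta_ge Hy _ Hc H0); [|exact Ht].
  intros u Hu. destruct (Hphi u Hu) as [Ec Es]. rewrite dY_eq in Es by assumption.
  rewrite <- amplitude_energy by assumption. split.
  - rewrite Ec at 1. ring.
  - rewrite Es at 1. ring.
Qed.

Lemma radau_phase_lt_end (m : nat) (t : R) : (1 <= m)%nat -> 0 <= t < PI ->
  radau_phase m t < phase_end m.
Proof.
  intros Hm Ht. apply Rnot_le_lt. intros Hge.
  assert (Hsys := prufer_system_radau m Hm).
  assert (Hy := radau_equation_Y beta m beta_ge Hm). assert (Hpi := PI_RGT_0).
  (* [prufer_phase_onto] needs a value strictly above the target; the midpoint with [PI] supplies it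
     even for [phase_end m]. *)
  assert (Hgt : radau_phase m t < radau_phase m ((t + PI) / 2)).
  { apply (prufer_incr _ _ _ _ Hsys); lra. }
  (* The indices 0 to m - 1 give m distinct zeros of Y in [(0, PI)], hence m roots of a polynomial
     of degree at most m - 1 whose value at 1 is 1. *)
  set (zero i := epsilon (inhabits 0) (fun z => 0 < z < PI /\ radau_phase m z = phase_end (S i))).
  assert (Hzero : forall i, (i <= m - 1)%nat ->
    0 < zero i < PI /\ radau_phase m (zero i) = phase_end (S i)).
  { intros i Hi. unfold zero. apply epsilon_spec.
    assert (Hi0 := pos_INR i).
    assert (Him : INR (S i) <= INR m) by (apply le_INR; lia).
    apply (prufer_phase_onto _ _ _ _ Hsys _ ((t + PI) / 2)); [|lra|].
    - unfold phase_end. rewrite S_INR. apply Rmult_lt_0_compat; lra.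
    - apply Rle_lt_trans with (phase_end m); [|lra].
      unfold phase_end. apply Rmult_le_compat_r; lra. }
  assert (Hroot : forall u, jacobi (m - 1) 0 (beta + 1) (1 + 2 * u) = 0).
  { apply (polynomial_le_roots (m - 1) _ (fun i => (cos (zero i) - 1) / 2)
             (polynomial_le_jacobi (m - 1) (beta + 1))).
    - intros i Hi. destruct (Hzero i Hi) as [Hr E].
      replace (1 + 2 * ((cos (zero i) - 1) / 2)) with (cos (zero i)) by field.
      destruct (phase_int_lift _ _ _ _ _ beta_ge Hy (zero i) ltac:(lra)) as [Ec _].
      fold (radau_phase m) in Ec. rewrite E, cos_phase_end, Rmult_0_r in Ec.
      assert (Hw := omega_pos beta m beta_ge Hm).
      apply Rmult_integral in Ec as [Ec|Ec]; [lra|].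
      unfold Y in Ec. rewrite Q_interior in Ec by (apply cos_gt_m1; lra).
      apply Rmult_integral in Ec as [Ec|Ec]; [exfalso|exact Ec].
      apply Rmult_integral in Ec as [Ec|Ec]; revert Ec; apply Rgt_not_eq, exp_pos.
    - intros i j Hij E.
      destruct (Hzero i ltac:(lia)) as [Hri Ei]. destruct (Hzero j ltac:(lia)) as [Hrj Ej].
      assert (Ez : zero i = zero j) by (apply cos_inj; lra).
      rewrite Ez, Ej in Ei. unfold phase_end in Ei.
      apply Rmult_eq_reg_r in Ei; [|lra].
      assert (Hij' : INR j = INR i) by (rewrite !S_INR in Ei; lra).
      apply INR_eq in Hij'. lia. }
  specialize (Hroot 0). replace (1 + 2 * 0) with 1 in Hroot by ring.
  rewrite jacobi_1 in Hroot. lra.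
Qed.

Lemma omega_lt (m : nat) : (1 <= m)%nat -> omega beta m < omega beta (S m).
Proof.
  intros Hm. assert (1 <= INR m) by (apply (le_INR 1 m Hm)).
  apply sqrt_lt_1_alt. rewrite S_INR. split; nra.
Qed.

Lemma radau_phase_tends (m : nat) : (1 <= m)%nat ->
  phase_tends (radau_phase m) (phase_end m).
Proof.
  intros Hm. assert (Hpi := PI_RGT_0).
  assert (Hstep : forall j, phase_end (S j) = phase_end j + PI).
  { intros j. unfold phase_end. rewrite S_INR. ring. }
  induction m as [|m IH]; [lia|].
  assert (Hsys := prufer_system_radau (S m) Hm).
  assert (Hreach : exists t, 0 <= t < PI /\ phase_end m <= radau_phase (S m) t).
  { destruct m as [|m].
    (* [phase_end 0] is [- (PI / 2)], below the initial phase 0, so the case of index 1 requires no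
       preceding phase. *)
    - exists 0. split; [lra|]. rewrite (prufer_phi0 Hsys).
      unfold phase_end. simpl. lra.
    - assert (Hm' : (1 <= S m)%nat) by lia.
      apply (next_phase_reaches _ _ _ _ _ _ _ beta_ge (prufer_system_radau (S m) Hm') Hsys
               (omega_lt (S m) Hm')); [apply cos_phase_end|apply IH, Hm']. }
  destruct Hreach as [t [Ht Hle]]. rewrite Hstep.
  apply (phase_tends_of_bounds _ _ _ _ Hsys _ t (cos_phase_end m) Ht Hle).
  intros u Hu. rewrite <- Hstep. apply radau_phase_lt_end; assumption.
Qed.

Lemma Theta_interior (m : nat) (s : R) : (1 <= m)%nat -> 0 < s < phase_end m ->
  0 < Theta beta m s < PI /\ radau_phase m (Theta beta m s) = s.
Proof.
  intros Hm Hs. assert (Hsys := prufer_system_radau m Hm).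
  destruct (radau_phase_tends m Hm) as [_ Hsup].
  destruct (Hsup (phase_end m - s)) as [t1 [Ht1 Hlt]]; [lra|].
  destruct (prufer_phase_onto _ _ _ _ Hsys s t1) as [t [Ht E]]; try lra.
  assert (Hex : exists t, 0 <= t <= PI /\ phase beta m t = s).
  { exists t. split; [lra|]. rewrite phase_eq by (assumption || lra). exact E. }
  apply (epsilon_spec (inhabits 0)) in Hex. fold (Theta beta m s) in Hex.
  destruct Hex as [Hr Hp].
  (* The value [PI], also admissible for [epsilon], is excluded because the phase there is
     [phase_end m], which differs from [s]. *)
  assert (Hlt' : Theta beta m s < PI).
  { apply Rnot_le_lt. intros Hge. unfold phase in Hp.
    destruct (Rlt_dec (Theta beta m s) PI); lra. }
  rewrite phase_eq in Hp by (assumption || lra).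
  split; [|exact Hp]. split; [|exact Hlt'].
  destruct (proj1 Hr) as [H|H]; [exact H|exfalso].
  rewrite <- H, (prufer_phi0 Hsys) in Hp. lra.
Qed.

Lemma Theta_end (m : nat) : (1 <= m)%nat -> Theta beta m (phase_end m) = PI.
Proof.
  intros Hm. assert (Hpi := PI_RGT_0).
  assert (Hex : exists t, 0 <= t <= PI /\ phase beta m t = phase_end m).
  { exists PI. split; [lra|]. unfold phase. destruct (Rlt_dec PI PI); lra. }
  apply (epsilon_spec (inhabits 0)) in Hex. fold (Theta beta m (phase_end m)) in Hex.
  destruct Hex as [Hr Hp].
  destruct (Rlt_le_dec (Theta beta m (phase_end m)) PI) as [H|H]; [exfalso|lra].
  rewrite phase_eq in Hp by (assumption || lra).
  assert (Hlt := radau_phase_lt_end m (Theta beta m (phase_end m)) Hm ltac:(lra)). lra.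
Qed.

Lemma amplitude_PI (m : nat) : amplitude beta m PI = 0.
Proof.
  unfold amplitude, dY. rewrite Y_at_PI.
  rewrite (is_derive_unique _ _ _ (is_derive_Y_PI beta m beta_ge)).
  transitivity (sqrt 0); [f_equal; unfold Rdiv; ring|apply sqrt_0].
Qed.

End RadauPhase.

Theorem theorem4p4 :
  forall beta : R, - (1 / 3) <= beta ->
  forall m : nat, (1 <= m)%nat ->
  forall s : R, 0 < s <= phase_end m ->
    Theta beta (m + 1) s < Theta beta m s /\
    amplitude_of_phase beta (m + 1) s > amplitude_of_phase beta m s.
Proof.
  intros beta Hb m Hm s [Hs0 Hs].
  rewrite Nat.add_1_r. assert (Hm' : (1 <= S m)%nat) by lia. assert (Hpi := PI_RGT_0).
  assert (Hends : phase_end m < phase_end (S m)).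
  { unfold phase_end. rewrite S_INR. apply Rmult_lt_compat_r; lra. }
  assert (Hsys1 := prufer_system_radau beta Hb m Hm).
  assert (Hsys2 := prufer_system_radau beta Hb (S m) Hm').
  assert (Hw := omega_lt beta Hb m Hm).
  assert (Hth1 := fun s => Theta_interior beta Hb m s Hm).
  assert (Hth2 : forall s, 0 < s < phase_end m ->
    0 < Theta beta (S m) s < PI /\ radau_phase beta (S m) (Theta beta (S m) s) = s).
  { intros u Hu. apply (Theta_interior beta Hb (S m) u Hm'). lra. }
  unfold amplitude_of_phase. destruct Hs as [Hs|Hs].
  - destruct (Hth1 s ltac:(lra)) as [H1 _]. destruct (Hth2 s ltac:(lra)) as [H2 _].
    split; [exact (theta_lt _ _ _ _ _ _ _ Hsys1 Hsys2 Hw _ _ _ Hth1 Hth2 s ltac:(lra))|].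
    rewrite !amplitude_eq by (assumption || lra).
    apply sqrt_lt_1_alt. split.
    + left. apply (prufer_r2_pos Hsys1). lra.
    + apply (amplitude_sqr_lt _ _ _ _ _ _ _ Hb Hsys1 Hsys2 Hw (phase_end m)
               _ _ ltac:(lra) Hth1 Hth2). lra.
  (* The end of the range of index m is outside the open interval of the comparison: the angle is
     [PI] and the amplitude 0, while for index m + 1 the same phase is interior. *)
  - subst s. rewrite Theta_end, amplitude_PI by assumption.
    destruct (Theta_interior beta Hb (S m) (phase_end m) Hm' ltac:(lra)) as [H2 _].
    split; [lra|]. rewrite amplitude_eq by (assumption || lra).
    apply sqrt_lt_R0. apply (prufer_r2_pos Hsys2). lra.
Qed.
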